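(* With probability one there exists $n_0$ such that for every $n\ge n_0$ the function $\mathbb R^4\ni(\alpha',\mu'_\varepsilon,\theta_1',\theta_2')\mapsto Q_n(\mathbf Y_n;\alpha',\mu'_\varepsilon,\theta_1',\theta_2')$ has a unique global minimizer $(\hat\alpha_n,\hat\mu_{\varepsilon,n},\hat\theta_{1,n},\hat\theta_{2,n})$, given by $$\hat\alpha_n=\frac{(n-2)\sum^{*}Y_{k-1}Y_k-\sum^{*}Y_k\sum^{*}Y_{k-1}}{D_n},\quad\hat\mu_{\varepsilon,n}=\frac{\sum^{*}Y_{k-1}^2\sum^{*}Y_k-\sum^{*}Y_{k-1}\sum^{*}Y_{k-1}Y_k}{D_n},\quad\hat\theta_{i,n}=Y_{s_i}-\hat\alpha_nY_{s_i-1}-\hat\mu_{\varepsilon,n},$$ where $\sum^*$ denotes $\sum_{k=1,k\notin\{s_1,s_2\}}^n$ and $D_n=(n-2)\sum^*Y_{k-1}^2-(\sum^*Y_{k-1})^2$. Moreover, for every $(\alpha,\mu_\varepsilon,\theta_1,\theta_2)\in(0,1)\times(0,\infty)\times\mathbb N^2$, almost surely $\hat\alpha_n\to\alpha$, $\hat\mu_{\varepsilon,n}\to\mu_\varepsilon$ and $\hat\theta_{i,n}\to Y_{s_i}-\alpha Y_{s_i-1}-\mu_\varepsilon$, $i=1,2$.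
   Context: INAR(1) with two innovational outliers: Let $\alpha\in(0,1)$. Let $(\varepsilon_k)_{k\in\mathbb N}$ be i.i.d. non-negative integer-valued random variables with $\mathbb E\varepsilon_1^2<\infty$ and $\mathbb P(\varepsilon_1\ne 0)>0$; write $\mu_\varepsilon=\mathbb E\varepsilon_1$. For each $k\in\mathbb N$ let $(\xi_{k,j})_{j\in\mathbb N}$ be i.i.d. Bernoulli random variables with mean $\alpha$, these sequences being mutually independent and independent of $(\varepsilon_k)$. Fix known times $s_1\ne s_2$ in $\mathbb N$ and sizes $\theta_1,\theta_2\in\mathbb N$. Let $Y_0$ be a non-negative integer-valued random variable with $\mathbb E Y_0^2<\infty$, independent of all $\xi_{k,j},\varepsilon_k$, and $Y_k=\sum_{j=1}^{Y_{k-1}}\xi_{k,j}+\varepsilon_k+\delta_{k,s_1}\theta_1+\delta_{k,s_2}\theta_2$, $k\in\mathbb N$. Write $\mathbf Y_n=(Y_0,\dots,Y_n)$. For $n\ge\max(s_1,s_2)$, $$Q_n(\mathbf y_n;\alpha',\mu'_\varepsilon,\theta_1',\theta_2')=\sum_{\substack{k=1\\k\notin\{s_1,s_2\}}}^n(y_k-\alpha'y_{k-1}-\mu'_\varepsilon)^2+\sum_{i=1}^2(y_{s_i}-\alpha'y_{s_i-1}-\mu'_\varepsilon-\theta_i')^2 .$$ *)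

(* Defs.v *)
From HB Require Import structures.
From mathcomp Require Import all_boot all_order all_algebra.
From mathcomp Require Import all_classical all_reals all_analysis.
Set Implicit Arguments. Unset Strict Implicit. Unset Printing Implicit Defensive.
Import Order.TTheory GRing.Theory Num.Theory.
Import numFieldNormedType.Exports.
Local Open Scope classical_set_scope.
Local Open Scope ring_scope.

Definition mutually_independent {d} {T : measurableType d} {R : realType}
  (P : probability T R) {I : eqType} (X : I -> T -> nat) : Prop :=
  forall (J : seq I) (B : I -> set nat), uniq J ->
    P (\big[setI/setT]_(i <- J) (X i @^-1` B i)) =
    (\prod_(i <- J) P (X i @^-1` B i))%E.

Definition inar_family {T : Type} (eps : nat -> T -> nat)
  (xi : nat -> nat -> T -> nat) (Y0 : T -> nat) :
  ((nat + (nat * nat)) + unit) -> T -> nat :=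
  fun i => match i with
           | inl (inl k) => eps k.+1
           | inl (inr (k, j)) => xi k.+1 j.+1
           | inr _ => Y0
           end.

(* Pathwise INAR(1) recursion with two innovational outliers:
   Y_k = sum_{j=1}^{Y_{k-1}} xi_{k,j} + eps_k + [k = s1] th1 + [k = s2] th2. *)
Fixpoint inar (y0 : nat) (eps : nat -> nat) (xi : nat -> nat -> nat)
  (s1 s2 th1 th2 : nat) (k : nat) : nat :=
  if k is k'.+1 then
    (\sum_(1 <= j < (inar y0 eps xi s1 s2 th1 th2 k').+1) xi k j)
    + eps k + (if k == s1 then th1 else 0) + (if k == s2 then th2 else 0)
  else y0.

Definition sstar {R : realType} (n s1 s2 : nat) (f : nat -> R) : R :=
  \sum_(1 <= k < n.+1 | (k != s1) && (k != s2)) f k.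

Definition Qn {R : realType} (y : nat -> R) (n s1 s2 : nat) (a m t1 t2 : R) : R :=
  sstar n s1 s2 (fun k => (y k - a * y k.-1 - m) ^+ 2)
  + (y s1 - a * y s1.-1 - m - t1) ^+ 2
  + (y s2 - a * y s2.-1 - m - t2) ^+ 2.

Definition Dn {R : realType} (y : nat -> R) (n s1 s2 : nat) : R :=
  (n%:R - 2) * sstar n s1 s2 (fun k => y k.-1 ^+ 2)
  - (sstar n s1 s2 (fun k => y k.-1)) ^+ 2.

Definition alpha_hat {R : realType} (y : nat -> R) (n s1 s2 : nat) : R :=
  ((n%:R - 2) * sstar n s1 s2 (fun k => y k.-1 * y k)
   - sstar n s1 s2 y * sstar n s1 s2 (fun k => y k.-1)) / Dn y n s1 s2.

Definition mu_hat {R : realType} (y : nat -> R) (n s1 s2 : nat) : R :=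
  (sstar n s1 s2 (fun k => y k.-1 ^+ 2) * sstar n s1 s2 y
   - sstar n s1 s2 (fun k => y k.-1) * sstar n s1 s2 (fun k => y k.-1 * y k))
  / Dn y n s1 s2.

Definition theta_hat {R : realType} (y : nat -> R) (n s1 s2 s : nat) : R :=
  y s - alpha_hat y n s1 s2 * y s.-1 - mu_hat y n s1 s2.

Definition unique_global_minimizer {R : realType} (f : R -> R -> R -> R -> R)
  (a m t1 t2 : R) : Prop :=
  (forall a' m' t1' t2', f a m t1 t2 <= f a' m' t1' t2') /\
  (forall a' m' t1' t2',
     (forall a'' m'' t1'' t2'', f a' m' t1' t2' <= f a'' m'' t1'' t2'') ->
     (a', m', t1', t2') = (a, m, t1, t2)).

(* Main.v *)
(** Write [e_k = Y_k - alpha Y_(k-1) - mu] for the residuals away from the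
    outlier times.  The errors of the estimators are quotients of
    [sum e_k] and [sum Y_(k-1) e_k] by [D_n], so it suffices that both sums are
    a.s. [o(n)] and that [D_n >= c n^2] eventually.

    Only second moments are available, so [Y_(k-1) e_k] may have infinite
    variance.  It is split into immigration [Y_(k-1) (eps_k - mu)], with bounded
    variance, and thinning [Y_(k-1) sum_j (xi_(k,j) - alpha)], which is truncated
    on [Y_(k-1) <= (3/2)^m] for [k] of order [2^m]: since [(3/2)^2 > 2] the
    truncation is a.s. eventually inactive, and since [3/2 < 2] the truncated
    variances are small enough for a law of large numbers for orthogonal
    variables, obtained from a dyadic chaining (Rademacher-Menshov) bound.
    Orthogonality comes from independence of each coordinate from the sigma-algebra
    generated by all the others.

    For [D_n], the residual sum of squares of [Y] is tested against a bounded
    sequence [w_k] with [sum w_k = o(n)] and [sum Y_k w_k >= c n], which avoids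
    any ergodic theorem for [sum Y_k^2]. *)
Require Import Defs.
From HB Require Import structures.
From mathcomp Require Import all_boot all_order all_algebra.
From mathcomp Require Import all_classical all_reals all_analysis.
From mathcomp Require Import measurable_realfun.
From mathcomp Require Import ring lra zify.
Import Order.TTheory GRing.Theory Num.Theory.
Import numFieldNormedType.Exports.
Set Implicit Arguments. Unset Strict Implicit. Unset Printing Implicit Defensive.
Local Open Scope classical_set_scope.
Local Open Scope ring_scope.

(** * Least squares along a fixed path *)

(** Given the past, the thinning error at time [k] has variance [alpha (1 - alpha) Y_(k-1)], so its
    product with [Y_(k-1)] would call for a third moment, whereas the immigration error has constant
    variance. Truncation replaces [Y^3] by [(3/2)^m Y^2]. Then [2^m] terms of variance of order
    [(3/2)^m] contribute order [3^m] on each dyadic scale. Two linear factors [m + 1], one from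
    counting scales and one from chaining, are absorbed at the price of a ratio [31/30] each, and
    [3 (31/30)^2 < 4] leaves room for squared partial sums that are [o(4^m)]. The test sequence
    isolates one particle: when it exists, [Y_k] is its survival indicator plus a remainder
    independent of that indicator, so [Y_k w_k] has mean [alpha (1 - alpha) P(eps <> 0) > 0] for
    [k >= 2], while [w_k] is centred. The remainder contains other innovations of the same time [k],
    so a filtration indexed by time would not separate it from the indicator. Hence each coordinate
    is compared with all the others and not merely with the past. *)

Definition sublinear {R : realType} (u : nat -> R) :=
  forall e : R, 0 < e -> exists n0, forall n, (n0 <= n)%N -> `|u n| <= e * n%:R.

Section restricted_sums.
Context {R : realType} (s1 s2 : nat).
Implicit Types (f g : nat -> R) (n : nat).
Local Notation S n f := (@sstar R n s1 s2 f).

Lemma eq_sstar n f g : f =1 g -> S n f = S n g.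
Proof. by move=> fg; apply: eq_bigr => k _; rewrite fg. Qed.

Lemma sstarD n f g : S n (fun k => f k + g k) = S n f + S n g.
Proof. exact: big_split. Qed.

Lemma sstarZ n a f : S n (fun k => a * f k) = a * S n f.
Proof. by rewrite /sstar big_distrr. Qed.

Lemma sstar_ge0 n f : (forall k, 0 <= f k) -> 0 <= S n f.
Proof. by move=> f0; exact: sumr_ge0. Qed.

Lemma sstar_full n f : (0 < s1 <= n)%N -> (0 < s2 <= n)%N -> s1 != s2 ->
  \sum_(1 <= k < n.+1) f k = S n f + f s1 + f s2.
Proof.
move=> h1 h2 h12; rewrite (bigD1_seq s1) ?iota_uniq//=; last first.
  by rewrite mem_index_iota; lia.
rewrite big_mkcond (bigD1_seq s2) ?iota_uniq//=; last first.
  by rewrite mem_index_iota; lia.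
rewrite [s2 == s1]eq_sym h12 -big_mkcondr /sstar.
rewrite (eq_bigl (fun k => (k != s1) && (k != s2))) => [|k]; last by rewrite andbC.
by ring.
Qed.

Lemma sstar1 n : (0 < s1 <= n)%N -> (0 < s2 <= n)%N -> s1 != s2 ->
  S n (fun=> 1) = n%:R - 2.
Proof.
move=> h1 h2 h12; have := sstar_full (fun=> 1) h1 h2 h12.
rewrite sumr_const_nat subn1/= => ->; ring.
Qed.

Lemma sstar_expand_Qn n (y : nat -> R) (a m t1 t2 : R) :
  (0 < s1 <= n)%N -> (0 < s2 <= n)%N -> s1 != s2 ->
  Qn y n s1 s2 a m t1 t2 =
    S n (fun k => y k ^+ 2) + a ^+ 2 * S n (fun k => y k.-1 ^+ 2)
    + m ^+ 2 * (n%:R - 2) - 2 * a * S n (fun k => y k.-1 * y k)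
    - 2 * m * S n y + 2 * a * m * S n (fun k => y k.-1)
    + (y s1 - a * y s1.-1 - m - t1) ^+ 2
    + (y s2 - a * y s2.-1 - m - t2) ^+ 2.
Proof.
move=> h1 h2 h12; rewrite /Qn; congr (_ + _ + _).
rewrite -(sstar1 h1 h2 h12) -!mulNr -!sstarZ -!sstarD.
by apply: eq_sstar => k; ring.
Qed.

(** Completing the square: [n - 2] times the excess of [Qn] over its value at the estimators is a
    sum of squares with positive weights ([gapE]), and these vanish together only at the estimators.
    The outlier residuals are zero there by the choice of [theta_hat]. *)
Lemma Dn_gt0_minimizer n (y : nat -> R) :
  (0 < s1 <= n)%N -> (0 < s2 <= n)%N -> s1 != s2 -> 0 < Dn y n s1 s2 ->
  unique_global_minimizer (Qn y n s1 s2)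
    (alpha_hat y n s1 s2) (mu_hat y n s1 s2)
    (theta_hat y n s1 s2 s1) (theta_hat y n s1 s2 s2).
Proof.
move=> h1 h2 h12 D0.
set ah := alpha_hat _ _ _ _; set mh := mu_hat _ _ _ _.
have ahE : ah * Dn y n s1 s2 = (n%:R - 2) * S n (fun k => y k.-1 * y k)
   - S n y * S n (fun k => y k.-1) by rewrite /ah /alpha_hat divfK// gt_eqF.
have mhE : mh * Dn y n s1 s2 = S n (fun k => y k.-1 ^+ 2) * S n y
   - S n (fun k => y k.-1) * S n (fun k => y k.-1 * y k).
  by rewrite /mh /mu_hat divfK// gt_eqF.
have xx0 : 0 <= S n (fun k => y k.-1 ^+ 2) by apply: sstar_ge0 => k; exact: sqr_ge0.
(* If [n - 2 <= 0], both terms of [Dn] are nonpositive. *)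
have N0 : 0 < n%:R - 2 :> R.
  rewrite ltNge; apply/negP => N0; move: D0; rewrite /Dn ltNge => /negP; apply.
  by rewrite subr_le0 (le_trans _ (sqr_ge0 _))// mulr_le0_ge0.
have gapE a m t1 t2 : (n%:R - 2) * (Qn y n s1 s2 a m t1 t2
    - Qn y n s1 s2 ah mh (theta_hat y n s1 s2 s1) (theta_hat y n s1 s2 s2)) =
    ((n%:R - 2) * (m - mh) + S n (fun k => y k.-1) * (a - ah)) ^+ 2
    + Dn y n s1 s2 * (a - ah) ^+ 2
    + (n%:R - 2) * ((y s1 - a * y s1.-1 - m - t1) ^+ 2
                    + (y s2 - a * y s2.-1 - m - t2) ^+ 2).
  rewrite !sstar_expand_Qn// /theta_hat -/ah -/mh.
  (* [e1] and [e2] are the normal equations; once they replace the sums involving the response,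
     [gapE] is a polynomial identity. *)
  have e1 : ah * S n (fun k => y k.-1 ^+ 2) + mh * S n (fun k => y k.-1) =
      S n (fun k => y k.-1 * y k).
    apply: (mulIf (lt0r_neq0 D0)); rewrite mulrDl [ah * _ * _]mulrAC [mh * _ * _]mulrAC ahE mhE.
    by rewrite /Dn; ring.
  have e2 : ah * S n (fun k => y k.-1) + mh * (n%:R - 2) = S n y.
    apply: (mulIf (lt0r_neq0 D0)); rewrite mulrDl [ah * _ * _]mulrAC [mh * _ * _]mulrAC ahE mhE.
    by rewrite /Dn; ring.
  by rewrite -e1 -e2 /Dn; ring.
have gap0 a m t1 t2 : 0 <= (n%:R - 2) * (Qn y n s1 s2 a m t1 t2
    - Qn y n s1 s2 ah mh (theta_hat y n s1 s2 s1) (theta_hat y n s1 s2 s2)).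
  rewrite gapE; apply: addr_ge0; last first.
    by rewrite mulr_ge0 ?(ltW N0)// addr_ge0 ?sqr_ge0.
  by rewrite addr_ge0 ?sqr_ge0// mulr_ge0 ?sqr_ge0// ltW.
split=> [a m t1 t2|a m t1 t2 min].
  by have := gap0 a m t1 t2; rewrite pmulr_rge0// subr_ge0.
have : (n%:R - 2) * (Qn y n s1 s2 a m t1 t2
    - Qn y n s1 s2 ah mh (theta_hat y n s1 s2 s1) (theta_hat y n s1 s2 s2)) <= 0.
  by rewrite pmulr_rle0// subr_le0.
rewrite gapE => le0.
have p1 := sqr_ge0 ((n%:R - 2) * (m - mh) + S n (fun k => y k.-1) * (a - ah)).
have p2 : 0 <= Dn y n s1 s2 * (a - ah) ^+ 2 by rewrite mulr_ge0 ?sqr_ge0// ltW.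
have p3 : 0 <= (n%:R - 2) * (y s1 - a * y s1.-1 - m - t1) ^+ 2.
  by rewrite mulr_ge0 ?sqr_ge0// ltW.
have p4 : 0 <= (n%:R - 2) * (y s2 - a * y s2.-1 - m - t2) ^+ 2.
  by rewrite mulr_ge0 ?sqr_ge0// ltW.
have sq0 (c x : R) : 0 < c -> c * x ^+ 2 <= 0 -> x = 0.
  move=> c0; rewrite pmulr_rle0// => x2; apply/eqP.
  by rewrite -sqrf_eq0; apply/eqP/le_anti; rewrite x2 sqr_ge0.
have ea : a - ah = 0 by apply: (sq0 _ _ D0); lra.
move: p1 le0; rewrite ea mulr0 addr0 expr0n/= mulr0 addr0 => p1 le0.
have em : m - mh = 0.
  have /eqP : (n%:R - 2) * (m - mh) = 0 by apply: (sq0 1) => //; lra.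
  by rewrite mulf_eq0 gt_eqF//= => /eqP.
have et1 : y s1 - a * y s1.-1 - m - t1 = 0 by apply: (sq0 _ _ N0); lra.
have et2 : y s2 - a * y s2.-1 - m - t2 = 0 by apply: (sq0 _ _ N0); lra.
have eqa : a = ah by lra.
have eqm : m = mh by lra.
rewrite -eqa -eqm.
rewrite /theta_hat -/ah -/mh -eqa -eqm; congr (_, _, _, _); lra.
Qed.

End restricted_sums.

(** * Sequences that are [o(n)] *)

Section sublinear_theory.
Context {R : realType}.
Implicit Types u v x y : nat -> R.

Lemma eq_sublinear u v : u =1 v -> sublinear u -> sublinear v.
Proof. by move=> uv su e /su[n0 n0P]; exists n0 => n /n0P; rewrite uv. Qed.

Lemma sublinearD u v : sublinear u -> sublinear v -> sublinear (fun n => u n + v n).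
Proof.
move=> su sv e e0; have e20 : 0 < e / 2 by rewrite divr_gt0.
have [n1 n1P] := su _ e20; have [n2 n2P] := sv _ e20.
exists (maxn n1 n2) => n; rewrite geq_max => /andP[/n1P h1 /n2P h2].
by rewrite (le_trans (ler_normD _ _))//; lra.
Qed.

Lemma sublinearZ a u : sublinear u -> sublinear (fun n => a * u n).
Proof.
move=> su e e0; have a1 : 0 < 1 + `|a| by rewrite ltr_pwDl.
have [|n0 n0P] := su (e / (1 + `|a|)); first by rewrite divr_gt0.
exists n0 => n /n0P h; rewrite normrM.
apply: (@le_trans _ _ ((1 + `|a|) * (e / (1 + `|a|) * n%:R))).
  by rewrite ler_pM// lerDr.
by rewrite mulrA mulrCA divff ?mulr1// gt_eqF.
Qed.

Lemma sublinear_bounded u (K : R) : (forall n, `|u n| <= K) -> sublinear u.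
Proof.
move=> uK e e0; have [N KN] : exists N : nat, K / e <= N%:R.
  by exists (Num.bound `|K / e|); rewrite (le_trans (ler_norm _))// ltW// archi_boundP.
exists N => n Nn; rewrite (le_trans (uK n))// mulrC -ler_pdivrMr//.
by rewrite (le_trans KN)// ler_nat.
Qed.

(** Serves to remove, along a path, the truncation and the outlier weights, each of which alters
    only finitely many terms. *)
Lemma sublinear_sum_eventually x y k0 : (forall k, (k0 <= k)%N -> x k = y k) ->
  sublinear (fun n => \sum_(k < n) x k) -> sublinear (fun n => \sum_(k < n) y k).
Proof.
move=> xy sx.
apply: (@eq_sublinear (fun n => \sum_(k < n) x k + \sum_(k < n) (y k - x k))).
  by move=> n; rewrite -big_split/=; apply: eq_bigr => k _; rewrite addrC subrK.
apply: sublinearD => //.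
apply: (@sublinear_bounded _ (\sum_(k < k0) `|y k - x k|)) => n.
apply: (le_trans (ler_norm_sum _ _ _)).
rewrite -(big_mkord xpredT (fun k => `|y k - x k|)).
rewrite -(big_mkord xpredT (fun k => `|y k - x k|)).
have [nk|kn] := leqP n k0.
  by rewrite [leRHS](big_cat_nat (leq0n _) nk)/= lerDl sumr_ge0.
rewrite [leLHS](big_cat_nat (leq0n _) (ltnW kn))/= gerDl big_nat big1// => k /andP[kk _].
by rewrite xy// subrr normr0.
Qed.

Lemma sublinear_shift r u : sublinear u -> sublinear (fun n => u (n - r)%N).
Proof.
move=> su e e0; have [n0 n0P] := su e e0.
exists (n0 + r)%N => n nr; apply: le_trans (n0P (n - r)%N _) _.
  by rewrite leq_subRL ?(leq_trans (leq_addl _ _) nr)// addnC.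
by rewrite ler_pM2l// ler_nat leq_subr.
Qed.

End sublinear_theory.

(** * Convergence of the estimators along a path *)

Section estimator_limits.
Context {R : realType} (s1 s2 : nat) (y : nat -> R) (a m : R).
Context (s1_gt0 : (0 < s1)%N) (s2_gt0 : (0 < s2)%N) (s12 : s1 != s2).
Context (y_ge0 : forall k, 0 <= y k) (a_lt1 : a < 1).
Local Notation S n f := (@sstar R n s1 s2 f).
Let e k := y k - a * y k.-1 - m.
Context (sum_e : sublinear (fun n => S n e)).
Context (sum_ye : sublinear (fun n => S n (fun k => y k.-1 * e k))).

(** Summing the residuals gives [S y = a S x + m (n - 2) + o(n)] for the lagged values [x]. Since
    [S x] exceeds [S y] by at most boundary and outlier values, [(1 - a) S x] is [O(n)]; this is
    where [a < 1] enters. In the constant, [c] is that boundary excess and [1] bounds the residual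
    sum. *)
Lemma lag_sum_linear : exists2 K : R, 0 < K &
  exists n0, forall n, (n0 <= n)%N -> S n (fun k => y k.-1) <= K * n%:R.
Proof.
pose c := y 0%N + y s1 + y s2.
have c0 : 0 <= c by rewrite !addr_ge0.
exists ((c + `|m| + 1) / (1 - a)).
  by rewrite divr_gt0 ?subr_gt0//; have := normr_ge0 m; lra.
have [n0 n0P] := sum_e ltr01.
exists (n0 + s1 + s2)%N => n nn0.
have h1 : (0 < s1 <= n)%N by lia.
have h2 : (0 < s2 <= n)%N by lia.
rewrite mulrAC ler_pdivlMr ?subr_gt0//.
have Ey : S n y - a * S n (fun k => y k.-1) - m * (n%:R - 2) = S n e.
  rewrite -(sstar1 h1 h2 s12) -!mulNr -!sstarZ -!sstarD.
  by apply: eq_sstar => k; rewrite /e; ring.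
have lagS : S n (fun k => y k.-1) - c <= S n y.
  have Sy := sstar_full y h1 h2 s12.
  have Sx := sstar_full (fun k => y k.-1) h1 h2 s12.
  have : \sum_(1 <= k < n.+1) y k.-1 <= y 0%N + \sum_(1 <= k < n.+1) y k.
    by rewrite big_add1/= -big_ltn// big_nat_recr//= lerDl.
  have := y_ge0 s1.-1; have := y_ge0 s2.-1; rewrite /c; lra.
have n1 : 1 <= n%:R :> R by rewrite ler1n; lia.
have := n0P n ltac:(lia); rewrite -Ey mul1r ler_norml => /andP[_ Se].
have mN : m * (n%:R - 2) <= `|m| * n%:R.
  rewrite (le_trans (ler_norm _))// normrM ler_wpM2l// ler_norml; lra.
have cn : c <= c * n%:R by rewrite ler_peMr.
set u := S n _ in lagS Se *.
set v := S n y in lagS Se; set x := n%:R in n1 Se mN cn *.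
clearbody c u v x; lra.
Qed.

Context (w : nat -> R) (c : R).
Context (c_gt0 : 0 < c) (w_le1 : forall k, `|w k| <= 1).
Context (sum_w : sublinear (fun n => S n (fun k => w k.-1))).
Context (sum_yw : exists n0, forall n, (n0 <= n)%N ->
  c * n%:R <= S n (fun k => y k.-1 * w k.-1)).

(* [Dn] is [N] times the residual sum of squares of [y] around its mean;
   testing that deviation against [w] gives [Dn >= 2 t N^2 c - t^2 N^2]
   up to lower order terms, for every [t]. *)
Lemma Dn_quadratic_growth : exists2 D : R, 0 < D &
  exists n0, forall n, (n0 <= n)%N -> D * n%:R ^+ 2 <= Dn y n s1 s2.
Proof.
have [K K0 [nK nKP]] := lag_sum_linear.
(* With the error terms below, the lower bound becomes [t (c - t) n^2], which for this [t] is three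
   times the claimed [c^2 / 16 * n^2]. *)
pose t := c / 4%:R.
have t0 : 0 < t by rewrite divr_gt0.
(* Chosen so that the cross term, at most [K n] times [e0 n], stays below [c / 4 * n^2]. The later
   offset [8] gives [n - 2 >= 3/4 n]. *)
have e0 : 0 < c / (4%:R * K) by rewrite divr_gt0// mulr_gt0.
have [nw nwP] := sum_w e0.
have [nyw nywP] := sum_yw.
exists (c ^+ 2 / 16%:R); first by rewrite divr_gt0// exprn_gt0.
exists (nK + nw + nyw + s1 + s2 + 8)%N => n hn.
have h1 : (0 < s1 <= n)%N by lia.
have h2 : (0 < s2 <= n)%N by lia.
have {nKP} SxK := nKP n ltac:(lia).
have {nwP} Sw := nwP n ltac:(lia).
have {nywP} Syw := nywP n ltac:(lia).
have sqE p z q : S n (fun k => (p * y k.-1 - z - q * w k.-1) ^+ 2) =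
    p ^+ 2 * S n (fun k => y k.-1 ^+ 2) + z ^+ 2 * (n%:R - 2)
    + q ^+ 2 * S n (fun k => w k.-1 ^+ 2) - 2 * p * z * S n (fun k => y k.-1)
    - 2 * p * q * S n (fun k => y k.-1 * w k.-1)
    + 2 * z * q * S n (fun k => w k.-1).
  rewrite -(sstar1 h1 h2 s12) -!mulNr -!sstarZ -!sstarD.
  by apply: eq_sstar => k; ring.
set Sx := S n (fun k => y k.-1) in SxK *.
set Sxx := S n (fun k => y k.-1 ^+ 2).
set Syw' := S n (fun k => y k.-1 * w k.-1) in Syw *.
set Sw' := S n (fun k => w k.-1) in Sw *.
have Sx0 : 0 <= Sx by exact: sstar_ge0.
have n8 : 8 <= n%:R :> R by rewrite (ler_nat R 8) (leq_trans _ hn)// leq_addl.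
set x := n%:R in n8 Sw Syw SxK *.
have ww : S n (fun k => w k.-1 ^+ 2) <= x - 2.
  rewrite -(sstar1 h1 h2 s12); apply: ler_sum => k _.
  by rewrite -real_normK ?num_real// exprn_ile1.
set Sww := S n (fun k => w k.-1 ^+ 2) in ww.
(* This is the squared distance between the deviation of [y] from its mean and [t w], scaled by
   [n - 2] to avoid a division; one factor [n - 2] then comes out of the expansion. *)
have : 0 <= S n (fun k => ((x - 2) * y k.-1 - Sx - (x - 2) * t * w k.-1) ^+ 2).
  by apply: sstar_ge0 => k; exact: sqr_ge0.
rewrite sqE -/x -/Sx -/Sxx -/Sww -/Syw' -/Sw'.
move=> sq.
have {sq} : 0 <= (x - 2) * (Dn y n s1 s2 + (x - 2) * t ^+ 2 * Sww
      - 2 * (x - 2) * t * Syw' + 2 * t * Sx * Sw').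
  apply: le_trans sq _; rewrite /Dn -/x -/Sx -/Sxx le_eqVlt; apply/orP; left.
  by apply/eqP; ring.
rewrite pmulr_rge0; last by lra.
have SxSw : Sx * Sw' <= c / 4%:R * x ^+ 2.
  rewrite (le_trans (ler_norm _))// normrM (ger0_norm Sx0).
  have -> : c / 4%:R * x ^+ 2 = (K * x) * (c / (4%:R * K) * x).
    by field; lra.
  by rewrite ler_pM.
have x34 : 3 / 4 * x <= x - 2 by lra.
have Hw : (x - 2) * t ^+ 2 * Sww <= t ^+ 2 * x ^+ 2.
  have -> : (x - 2) * t ^+ 2 * Sww = t ^+ 2 * ((x - 2) * Sww) by ring.
  rewrite ler_wpM2l ?sqr_ge0// expr2 ler_pM//; try lra.
  by apply: sstar_ge0 => k; exact: sqr_ge0.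
have Hyw : 3 / 4 * c * x ^+ 2 <= (x - 2) * Syw'.
  have -> : 3 / 4 * c * x ^+ 2 = (3 / 4 * x) * (c * x) by ring.
  by apply: ler_pM => //; [lra|rewrite mulr_ge0 ?(ltW c_gt0)//; lra].
have Hyw' := ler_wpM2l (ltW t0) Hyw.
have SxSw' := ler_wpM2l (ltW t0) SxSw.
have tE : 4%:R * t = c by rewrite /t; field.
have : t * (c / 4 * x ^+ 2) = t ^+ 2 * x ^+ 2 by rewrite -tE; field.
have : t * (3 / 4 * c * x ^+ 2) = 3 * (t ^+ 2 * x ^+ 2) by rewrite -tE; field.
have -> : c ^+ 2 / 16 * x ^+ 2 = t ^+ 2 * x ^+ 2 by rewrite -tE; field.
have : 0 <= t ^+ 2 * x ^+ 2 by rewrite mulr_ge0 ?sqr_ge0.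
lra.
Qed.

Lemma eventually_minimizer : exists n0 : nat, forall n : nat, (n0 <= n)%N ->
  unique_global_minimizer (Qn y n s1 s2)
    (alpha_hat y n s1 s2) (mu_hat y n s1 s2)
    (theta_hat y n s1 s2 s1) (theta_hat y n s1 s2 s2).
Proof.
have [D D0 [n0 n0P]] := Dn_quadratic_growth.
exists (n0 + s1 + s2)%N => n hn; apply: Dn_gt0_minimizer => //; try lia.
apply: (lt_le_trans _ (n0P n _)); last lia.
by rewrite mulr_gt0// exprn_gt0// ltr0n; lia.
Qed.

(** The numerators of both estimators are linear in the response and reproduce [a] and [m] exactly
    for the response [a * y k.-1 + m], so only the residual [e] is left in the error. *)
Lemma alpha_hat_error n : (0 < s1 <= n)%N -> (0 < s2 <= n)%N ->
  Dn y n s1 s2 != 0 ->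
  alpha_hat y n s1 s2 - a =
    ((n%:R - 2) * S n (fun k => y k.-1 * e k) - S n e * S n (fun k => y k.-1))
    / Dn y n s1 s2.
Proof.
move=> h1 h2 D0; apply: (mulIf D0); rewrite divfK// mulrBl divfK//.
have -> : S n (fun k => y k.-1 * e k) = S n (fun k => y k.-1 * y k)
    - a * S n (fun k => y k.-1 ^+ 2) - m * S n (fun k => y k.-1).
  rewrite -!mulNr -!sstarZ -!sstarD.
  by apply: eq_sstar => k; rewrite /e; ring.
have -> : S n e = S n y - a * S n (fun k => y k.-1) - m * (n%:R - 2).
  rewrite -(sstar1 h1 h2 s12) -!mulNr -!sstarZ -!sstarD.
  by apply: eq_sstar => k; rewrite /e; ring.
by rewrite /Dn; ring.
Qed.

Lemma mu_hat_error n : (0 < s1 <= n)%N -> (0 < s2 <= n)%N ->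
  Dn y n s1 s2 != 0 ->
  mu_hat y n s1 s2 - m =
    (S n (fun k => y k.-1 ^+ 2) * S n e
     - S n (fun k => y k.-1) * S n (fun k => y k.-1 * e k)) / Dn y n s1 s2.
Proof.
move=> h1 h2 D0; apply: (mulIf D0); rewrite divfK// mulrBl divfK//.
have -> : S n (fun k => y k.-1 * e k) = S n (fun k => y k.-1 * y k)
    - a * S n (fun k => y k.-1 ^+ 2) - m * S n (fun k => y k.-1).
  rewrite -!mulNr -!sstarZ -!sstarD.
  by apply: eq_sstar => k; rewrite /e; ring.
have -> : S n e = S n y - a * S n (fun k => y k.-1) - m * (n%:R - 2).
  rewrite -(sstar1 h1 h2 s12) -!mulNr -!sstarZ -!sstarD.
  by apply: eq_sstar => k; rewrite /e; ring.
by rewrite /Dn; ring.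
Qed.

Lemma alpha_hat_cvg : alpha_hat y n s1 s2 @[n --> \oo] --> a.
Proof.
have [K K0 [nK nKP]] := lag_sum_linear.
have [D D0 [nD nDP]] := Dn_quadratic_growth.
apply/cvgrPdist_le => d d0.
(* The two products in the numerator are at most [e0 n^2] and [K e0 n^2], to be compared with
   [d D n^2 <= d Dn]. *)
have e0 : 0 < d * D / (1 + K) by rewrite divr_gt0 ?mulr_gt0//; lra.
have [n1 n1P] := sum_e e0; have [n2 n2P] := sum_ye e0.
exists (nK + nD + n1 + n2 + s1 + s2 + 2)%N => //= n /= hn.
have [hK hD hn1 hn2] : [/\ nK <= n, nD <= n, n1 <= n & n2 <= n]%N.
  by clear -hn; split; lia.
have h1 : (0 < s1 <= n)%N by rewrite s1_gt0; clear -hn; lia.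
have h2 : (0 < s2 <= n)%N by rewrite s2_gt0; clear -hn; lia.
have {nKP} SxK := nKP n hK.
have {n1P} Se := n1P n hn1.
have {n2P} Sye := n2P n hn2.
have {nDP} Dge := nDP n hD.
have n_ge2 : 2 <= n%:R :> R by rewrite (ler_nat R 2) (leq_trans _ hn)// leq_addl.
have Dpos : 0 < Dn y n s1 s2.
  by apply: lt_le_trans Dge; rewrite mulr_gt0// exprn_gt0//; lra.
have Sx0 : 0 <= S n (fun k => y k.-1) by exact: sstar_ge0.
rewrite distrC alpha_hat_error ?gt_eqF//.
rewrite normrM normfV (gtr0_norm Dpos) ler_pdivrMr//.
apply: (@le_trans _ _ (d * (D * n%:R ^+ 2))); last by rewrite ler_pM2l.
rewrite (le_trans (ler_normB _ _))// !normrM (ger0_norm Sx0).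
have -> : d * (D * n%:R ^+ 2) = n%:R * (d * D / (1 + K) * n%:R) +
    d * D / (1 + K) * n%:R * (K * n%:R) by field; lra.
by rewrite lerD// ler_pM// ler_norml; lra.
Qed.

Lemma mu_hat_cvg : mu_hat y n s1 s2 @[n --> \oo] --> m.
Proof.
have [K K0 [nK nKP]] := lag_sum_linear.
have [D D0 [nD nDP]] := Dn_quadratic_growth.
apply/cvgrPdist_le => d d0.
(* The part [2 (D + K^2)] is the cost of the term with the sum of squares, through [SxxD]; the part
   [K] is the cost of the term with the lagged sum. *)
pose C := 2 * (D + K ^+ 2) + K.
have K2 : 0 <= K ^+ 2 by exact: sqr_ge0.
have C0 : 0 < C by rewrite /C; lra.
have e0 : 0 < d * D / C by rewrite divr_gt0 ?mulr_gt0.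
have [n1 n1P] := sum_e e0; have [n2 n2P] := sum_ye e0.
exists (nK + nD + n1 + n2 + s1 + s2 + 4)%N => //= n /= hn.
have [hK hD hn1 hn2] : [/\ nK <= n, nD <= n, n1 <= n & n2 <= n]%N.
  by clear -hn; split; lia.
have h1 : (0 < s1 <= n)%N by rewrite s1_gt0; clear -hn; lia.
have h2 : (0 < s2 <= n)%N by rewrite s2_gt0; clear -hn; lia.
have {nKP} SxK := nKP n hK.
have {n1P} Se := n1P n hn1.
have {n2P} Sye := n2P n hn2.
have {nDP} Dge := nDP n hD.
have n4 : 4 <= n%:R :> R by rewrite (ler_nat R 4) (leq_trans _ hn)// leq_addl.
have Dpos : 0 < Dn y n s1 s2.
  by apply: lt_le_trans Dge; rewrite mulr_gt0// exprn_gt0//; lra.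
have Sx0 : 0 <= S n (fun k => y k.-1) by exact: sstar_ge0.
have Sxx0 : 0 <= S n (fun k => y k.-1 ^+ 2) by apply: sstar_ge0 => k; exact: sqr_ge0.
rewrite distrC mu_hat_error ?gt_eqF//.
rewrite normrM normfV (gtr0_norm Dpos) ler_pdivrMr//.
rewrite (le_trans (ler_normB _ _))// !normrM (ger0_norm Sx0) (ger0_norm Sxx0).
set x := n%:R in SxK Se Sye Dge n4 *.
set Sx := S n (fun k => y k.-1) in SxK Sx0 *.
set Sxx := S n (fun k => y k.-1 ^+ 2) in Sxx0 *.
(* [Sxx] is [O(Dn / n)] although it need not be [O(n)] a priori. *)
have SxxD : D * x * Sxx <= 2 * (D + K ^+ 2) * Dn y n s1 s2.
  have Sx2 : Sx ^+ 2 <= K ^+ 2 * x ^+ 2.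
    by rewrite -exprMn lerXn2r ?nnegrE// mulr_ge0 ?(ltW K0)//; lra.
  have DE : (x - 2) * Sxx = Dn y n s1 s2 + Sx ^+ 2 by rewrite /Dn -/x -/Sx -/Sxx; ring.
  have : x * Sxx <= 2 * ((x - 2) * Sxx) by rewrite mulrA ler_wpM2r//; lra.
  rewrite DE => h.
  have := ler_wpM2l (ltW D0) h.
  have := ler_wpM2l (sqr_ge0 K) Dge.
  have := ler_wpM2l (ltW D0) Sx2.
  by rewrite -mulrA; lra.
have B1 : Sxx * `|S n e| <= d / C * (2 * (D + K ^+ 2) * Dn y n s1 s2).
  apply: (le_trans (ler_wpM2l Sxx0 Se)).
  have -> : Sxx * (d * D / C * x) = d / C * (D * x * Sxx) by field; lra.
  by rewrite ler_wpM2l// divr_ge0 ?ltW.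
have B2 : Sx * `|S n (fun k => y k.-1 * e k)| <= d / C * (K * Dn y n s1 s2).
  apply: (@le_trans _ _ (K * x * (d * D / C * x))); first by rewrite ler_pM.
  have -> : K * x * (d * D / C * x) = d / C * (K * (D * x ^+ 2)) by field; lra.
  by rewrite ler_pM2l ?divr_gt0// ler_pM2l.
apply: (le_trans (lerD B1 B2)); rewrite -mulrDr -mulrDl -/C.
by rewrite mulrA divfK// gt_eqF.
Qed.

Lemma theta_hat_cvg s :
  theta_hat y n s1 s2 s @[n --> \oo] --> y s - a * y s.-1 - m.
Proof.
apply: cvgB; last exact: mu_hat_cvg.
by apply: cvgB; [exact: cvg_cst|apply: cvgMl; exact: alpha_hat_cvg].
Qed.

End estimator_limits.
(** * A law of large numbers for orthogonal variables *)

Section square_integrable.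
Context {d : measure_display} {T : measurableType d} {R : realType}.
Variable P : probability T R.
Implicit Types X Y : T -> R.

Definition sqint X :=
  measurable_fun setT X /\ (\int[P]_t (X t ^+ 2)%:E < +oo)%E.

Lemma sqint_integrable X : sqint X -> P.-integrable setT (EFin \o (fun t => X t ^+ 2)).
Proof.
move=> [mX iX]; apply/integrableP; split.
  by apply/measurable_EFinP; exact: measurable_funX.
by under eq_integral do rewrite /= ger0_norm ?sqr_ge0//.
Qed.

Lemma sqint_of_integrable X : measurable_fun setT X ->
  P.-integrable setT (EFin \o (fun t => X t ^+ 2)) -> sqint X.
Proof.
move=> mX /integrableP[_ iX]; split => //.
by move: iX; under eq_integral do rewrite /= ger0_norm ?sqr_ge0//.
Qed.

Lemma sqint_mul X Y : sqint X -> sqint Y ->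
  P.-integrable setT (EFin \o (fun t => X t * Y t)).
Proof.
move=> sX sY; have iX := sqint_integrable sX; have iY := sqint_integrable sY.
apply: (le_integrable measurableT _ _ (integrableD measurableT iX iY)).
  by apply/measurable_EFinP/measurable_funM; [exact: sX.1|exact: sY.1].
move=> t _ /=; rewrite lee_fin [leRHS]ger0_norm ?addr_ge0 ?sqr_ge0//.
by rewrite normrM -(real_normK (num_real (X t))) -(real_normK (num_real (Y t)));
  have := sqr_ge0 (`|X t| - `|Y t|); have := normr_ge0 (X t);
  have := normr_ge0 (Y t); nra.
Qed.

Lemma sqint_le X Y : measurable_fun setT X -> (forall t, `|X t| <= `|Y t|) ->
  sqint Y -> sqint X.
Proof.
move=> mX XY sY; apply: sqint_of_integrable => //.
apply: (le_integrable measurableT _ _ (sqint_integrable sY)).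
  by apply/measurable_EFinP; exact: measurable_funX.
by move=> t _; rewrite /= lee_fin !normrX lerXn2r ?nnegrE.
Qed.

Lemma sqintD X Y : sqint X -> sqint Y -> sqint (fun t => X t + Y t).
Proof.
move=> sX sY; apply: sqint_of_integrable.
  by apply: measurable_funD; [exact: sX.1|exact: sY.1].
have iXY := sqint_mul sX sY.
rewrite (_ : _ \o _ = ((EFin \o (fun t => X t ^+ 2)%R) \+
  ((EFin \o (fun t => X t * Y t)%R) \+ ((EFin \o (fun t => X t * Y t)%R) \+
   (EFin \o (fun t => Y t ^+ 2)%R))))%E); last first.
  by apply/funext => t /=; rewrite -!EFinD; congr EFin; ring.
by do 3?[apply: integrableD => //]; exact: sqint_integrable.
Qed.

Lemma sqint_cst (c : R) : sqint (fun=> c).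
Proof.
split => //; rewrite (@integral_cst _ _ _ P _ measurableT (c ^+ 2)%:E).
by rewrite [X in (_ * X)%E](@probability_setT _ _ _ P) mule1 ltry.
Qed.

Lemma sqintZ (c : R) X : sqint X -> sqint (fun t => c * X t).
Proof.
move=> sX; apply: sqint_of_integrable.
  by apply: measurable_funM => //; exact: sX.1.
rewrite (_ : _ \o _ = (fun t => (c ^+ 2)%:E * (EFin \o (fun t => X t ^+ 2)%R) t)%E).
  by apply: integrableZl => //; exact: sqint_integrable.
by apply/funext => t /=; rewrite -EFinM exprMn.
Qed.

Lemma sqint_sum {I : Type} (r : seq I) (Q : pred I) (X : I -> T -> R) :
  (forall i, Q i -> sqint (X i)) -> sqint (fun t => \sum_(i <- r | Q i) X i t).
Proof.
move=> sX; elim: r => [|i r IH].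
  by rewrite [X in sqint X](_ : _ = fun=> 0); [exact: sqint_cst|
     apply/funext => t; rewrite big_nil].
rewrite [X in sqint X](_ : _ = fun t => (if Q i then X i t else 0) + \sum_(j <- r | Q j) X j t).
  apply: sqintD => //; by case: (boolP (Q i)) => Qi; [exact: sX|exact: sqint_cst].
by apply/funext => t; rewrite big_cons; case: ifP => // _; rewrite add0r.
Qed.

Lemma sqint_integrable1 X : sqint X -> P.-integrable setT (EFin \o X).
Proof.
move=> sX; have := sqint_mul sX (sqint_cst 1).
by rewrite (_ : _ \o _ = EFin \o X)//; apply/funext => t /=; rewrite mulr1.
Qed.

Lemma Rintegral_sum {I : Type} (r : seq I) (X : I -> T -> R) :
  (forall i, P.-integrable setT (EFin \o X i)) ->
  \int[P]_t (\sum_(i <- r) X i t) = \sum_(i <- r) \int[P]_t X i t.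
Proof.
move=> iX; elim: r => [|i r IH].
  under eq_Rintegral do rewrite big_nil; rewrite big_nil.
  by rewrite Rintegral_cst// mul0r.
under eq_Rintegral do rewrite big_cons; rewrite big_cons RintegralD// ?IH//.
rewrite (_ : _ \o _ = fun t => (\sum_(i <- r) (EFin \o X i) t)%E).
  exact: integrable_sum.
by apply/funext => t /=; rewrite sumEFin.
Qed.

Lemma fin_Rintegral X : P.-integrable setT (EFin \o X) ->
  (\int[P]_t (X t)%:E)%E = (\int[P]_t X t)%:E.
Proof. by move=> iX; rewrite /Rintegral fineK//; exact: integrable_fin_num. Qed.

(** The series of [U m / p ^ m] has a finite expectation, dominated by a geometric series of ratio
    [q / p]. It is therefore a.s. finite, and its sum is a random constant [K] bounding every
    term. *)
Lemma ae_geometric_bound (U : nat -> T -> R) (B p q : R) :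
  0 < q -> q < p ->
  (forall m, measurable_fun setT (U m)) -> (forall m t, 0 <= U m t) ->
  (forall m, (\int[P]_t (U m t)%:E <= (B * q ^+ m)%:E)%E) ->
  {ae P, forall t, exists K : R, forall m, U m t <= K * p ^+ m}.
Proof.
move=> q0 qp mU U0 iU.
have p0 : 0 < p by exact: lt_trans qp.
pose V m t : \bar R := (U m t * (p ^- m))%:E.
have V0 m t : (0 <= V m t)%E.
  by rewrite lee_fin mulr_ge0// invr_ge0 exprn_ge0// ltW.
have mV m : measurable_fun setT (V m).
  by apply/measurable_EFinP/measurable_funM.
have iV : (\int[P]_t (\sum_(m <oo) V m t) < +oo)%E.
  rewrite integral_nneseries//.
  apply: (@le_lt_trans _ _ (\sum_(m <oo) (B * (q / p) ^+ m)%:E)%E).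
    apply: lee_nneseries => [m _ _|m _]; first by apply: integral_ge0 => t _; exact: V0.
    rewrite /V; under eq_integral do rewrite mulrC EFinM.
    rewrite ge0_integralZl_EFin//; last 3 first.
      by move=> t _; rewrite lee_fin.
      exact/measurable_EFinP.
      by rewrite invr_ge0 exprn_ge0// ltW.
    rewrite expr_div_n mulrA [in leRHS]mulrC EFinM.
    by apply: lee_wpmul2l => //; rewrite lee_fin invr_ge0 exprn_ge0// ltW.
  rewrite (_ : (\sum_(m <oo) _)%E = (B / (1 - q / p))%:E) ?ltry//.
  apply/cvg_lim => //.
  rewrite (_ : (fun n => _) = EFin \o series (geometric B (q / p))).
    apply: cvg_EFin; first by near=> n.
    apply: cvg_geometric_series.
    by rewrite ger0_norm ?ltr_pdivrMr ?mul1r// divr_ge0// ltW.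
  by apply/funext => n /=; rewrite /series/= -sumEFin.
have mS : measurable_fun setT (fun t => \sum_(m <oo) V m t)%E.
  by apply: ge0_emeasurable_sum.
have : P.-integrable setT (fun t => \sum_(m <oo) V m t)%E.
  apply/integrableP; split => //.
  by under eq_integral do rewrite gee0_abs ?nneseries_ge0//.
move=> /(integrable_ae measurableT); apply: filterS => t /(_ I) fin.
exists (fine (\sum_(m <oo) V m t)%E) => m.
rewrite -ler_pdivrMr ?exprn_gt0// -lee_fin fineK//.
apply: (le_trans _ (nneseries_lim_ge m.+1 _)) => //.
rewrite big_mkord (bigD1 (Ordinal (ltnSn m)))//= leeDl// sume_ge0// => i _.
Unshelve. all: by end_near.
Qed.

End square_integrable.
(** The Rademacher-Menshov quantity: squared sums over all nodes of the dyadic tree on the [2 ^ m]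
    indices starting at [a]. Recursion on the two halves makes chaining an induction on [m]. *)
Fixpoint dyadic_energy {R : realType} (x : nat -> R) (m a : nat) : R :=
  if m is m'.+1 then
    (\sum_(a <= k < a + 2 ^ m) x k) ^+ 2
    + dyadic_energy x m' a + dyadic_energy x m' (a + 2 ^ m')
  else x a ^+ 2.

(** * Dyadic chaining for a fixed sequence *)

Section rademacher_menshov.
Context {R : realType}.
Implicit Type x : nat -> R.

Lemma dyadic_energy_ge0 x m a : 0 <= dyadic_energy x m a.
Proof.
by elim: m a => [|m IH] a /=; [exact: sqr_ge0|rewrite !addr_ge0 ?sqr_ge0].
Qed.

Lemma block_le_energy x m a :
  (\sum_(a <= k < a + 2 ^ m) x k) ^+ 2 <= dyadic_energy x m a.
Proof.
case: m => [|m] /=; first by rewrite expn0 addn1 big_nat1.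
by rewrite -addrA lerDl addr_ge0// dyadic_energy_ge0.
Qed.

(* [(u + v) ^ 2 <= (m + 2) (u ^ 2 + v ^ 2 / (m + 1))] absorbs one block per scale. *)
Lemma partial_sum_le_energy x m a n : (n <= 2 ^ m)%N ->
  (\sum_(a <= k < a + n) x k) ^+ 2 <= m.+1%:R * dyadic_energy x m a.
Proof.
elim: m a n => [|m IH] a n nm.
  rewrite mul1r; case: n nm => [|[|//]] _ /=.
    by rewrite addn0 big_geq// expr0n/= sqr_ge0.
  by rewrite addn1 big_nat1.
have E0 := dyadic_energy_ge0 x m.
have m1 : 1 <= m.+1%:R :> R by rewrite ler1n.
have m2 : m.+2%:R = m.+1%:R + 1 :> R by rewrite -natr1.
have [nm'|nm'] := leqP n (2 ^ m).
  apply: (le_trans (IH a n nm')) => /=.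
  have := E0 a; have := E0 (a + 2 ^ m)%N.
  have := sqr_ge0 (\sum_(a <= k < a + 2 ^ m.+1) x k).
  set u := _ ^+ 2; set v := dyadic_energy _ _ _; set w := dyadic_energy _ _ _.
  move=> u0 w0 v0; rewrite m2 mulrDl !mulrDr mul1r.
  have : 0 <= m.+1%:R * u by rewrite mulr_ge0.
  have : 0 <= m.+1%:R * v by rewrite mulr_ge0.
  lra.
have -> : \sum_(a <= k < a + n) x k = \sum_(a <= k < a + 2 ^ m) x k
    + \sum_(a + 2 ^ m <= k < a + 2 ^ m + (n - 2 ^ m)) x k.
  rewrite -addnA subnKC; last exact: ltnW.
  by rewrite -big_cat_nat//= ?leq_addr// leq_add2l ltnW.
have h1 := block_le_energy x m a.
have := IH (a + 2 ^ m)%N (n - 2 ^ m)%N.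
rewrite expnS mul2n -addnn in nm; rewrite leq_subLR => /(_ nm) h2 /=.
have := sqr_ge0 (\sum_(a <= k < a + 2 ^ m.+1) x k).
move: h1 h2; set u := \sum_(a <= k < a + 2 ^ m) _; set v := \sum_(_ <= k < _) _.
set w := (\sum_(a <= k < a + 2 ^ m.+1) _) ^+ 2.
set e1 := dyadic_energy _ _ a; set e2 := dyadic_energy _ _ _ => h1 h2 w0.
have e10 : 0 <= e1 by exact: E0.
have e20 : 0 <= e2 by exact: E0.
rewrite m2; set M := m.+1%:R in m1 h2 *.
have M0 : 0 < M by lra.
apply: (@le_trans _ _ ((M + 1) * (u ^+ 2 + v ^+ 2 / M))).
  rewrite -subr_ge0.
  have -> : (M + 1) * (u ^+ 2 + v ^+ 2 / M) - (u + v) ^+ 2 =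
    (M * u - v) ^+ 2 / M by field; lra.
  by rewrite divr_ge0 ?sqr_ge0// ltW.
rewrite ler_pM2l; last by lra.
have : u ^+ 2 + v ^+ 2 / M <= e1 + e2.
  by apply: lerD => //; rewrite ler_pdivrMr// mulrC.
by move/le_trans; apply; rewrite -addrA lerDr.
Qed.

(** Bernoulli's inequality for [1 + 1/30], multiplied by [30]. It turns a linear factor into a
    geometric one whose ratio is close enough to [1] to be used twice. *)
Lemma natr_le_geometric (m : nat) : m.+1%:R <= 30%:R * (31 / 30) ^+ m :> R.
Proof.
have : 1 + m%:R / 30 <= (31 / 30) ^+ m :> R.
  elim: m => [|m IH]; first by rewrite mul0r addr0 expr0.
  rewrite exprS -natr1; have m0 : 0 <= m%:R :> R by exact: ler0n.
  lra.
by rewrite -[m.+1%:R]natr1; lra.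
Qed.

(** For [n] between [2^(m-1)] and [2^m], chaining bounds the squared partial sum by
    [(m + 1) K (15/4)^m], which is [o(4^m)], while [4^m <= 4 n^2]. *)
Lemma sublinear_of_energy x (K : R) :
  (forall m, dyadic_energy x m 0 <= K * (15 / 4) ^+ m) ->
  sublinear (fun n => \sum_(k < n) x k).
Proof.
move=> EK e e0.
have K0 : 0 <= K.
  by have := EK 0%N; rewrite expr0 mulr1; apply: le_trans; exact: dyadic_energy_ge0.
(* Here [120 = 30 * 4], with [4] from [4^m / 4 <= n^2], and [31/30 * 15/4 = 4 * 31/32]. *)
have : (120%:R * K * (31 / 32) ^+ m) @[m --> \oo] --> (0 : R).
  by apply: cvg_geometric; rewrite ger0_norm; lra.
move/cvgrPdist_le => /(_ (e ^+ 2)); rewrite exprn_gt0// => /(_ isT) [m0 _ m0P].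
exists (2 ^ m0)%N => n n0.
have n_gt0 : (0 < n)%N by apply: leq_trans n0; rewrite expn_gt0.
pose m := (trunc_log 2 n).+1.
have nm : (n <= 2 ^ m)%N by rewrite ltnW// trunc_log_ltn.
have mn : (2 ^ m <= 2 * n)%N by rewrite expnS leq_mul2l trunc_logP.
have m0m : (m0 <= m)%N.
  by rewrite -(leq_exp2l (m := 2))//; exact: leq_trans nm.
rewrite -(ler_pXn2r (n := 2)) ?nnegrE ?mulr_ge0 ?(ltW e0)//.
rewrite real_normK ?num_real// exprMn -(big_mkord xpredT).
have := partial_sum_le_energy x 0 nm; rewrite add0n => /le_trans; apply.
have n2 : (4%:R ^+ m) / 4 <= n%:R ^+ 2 :> R.
  have : (2 ^+ m) <= 2 * n%:R :> R by rewrite -natrX -natrM ler_nat.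
  have p0 : 0 <= 2 ^+ m :> R by rewrite exprn_ge0.
  have -> : 4%:R ^+ m = (2 ^+ m) ^+ 2 :> R by rewrite exprAC; congr (_ ^+ _); lra.
  move=> h; have : (2 ^+ m) ^+ 2 <= (2 * n%:R) ^+ 2 :> R.
    by rewrite lerXn2r// nnegrE mulr_ge0.
  lra.
apply: (@le_trans _ _ (30%:R * (31 / 30) ^+ m * (K * (15 / 4) ^+ m))).
  by apply: ler_pM => //; [exact: dyadic_energy_ge0|exact: natr_le_geometric].
have := m0P m m0m; rewrite /= sub0r normrN ger0_norm; last first.
  by rewrite !mulr_ge0// exprn_ge0//; lra.
move=> h; apply: (le_trans _ (ler_wpM2l (sqr_ge0 e) n2)).
have -> : 30%:R * (31 / 30) ^+ m * (K * (15 / 4) ^+ m) =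
    120%:R * K * (31 / 32) ^+ m * (4%:R ^+ m / 4) :> R.
  have E : (31 / 30) ^+ m * (15 / 4) ^+ m = (31 / 32) ^+ m * 4%:R ^+ m :> R.
    by rewrite -!exprMn; congr (_ ^+ _); field.
  by rewrite mulrACA E; field.
by rewrite ler_wpM2r// divr_ge0// exprn_ge0.
Qed.

End rademacher_menshov.

(** * Strong law for orthogonal variables of slowly growing variance *)

Section orthogonal_slln.
Context {d : measure_display} {T : measurableType d} {R : realType}.
Variable P : probability T R.
Variable X : nat -> T -> R.
Context (X_sqint : forall k, sqint P (X k)).
Context (X_orth : forall j k, (j < k)%N -> \int[P]_t (X j t * X k t) = 0).

Lemma energy_integrable m a :
  P.-integrable setT (EFin \o (fun t => dyadic_energy (X^~ t) m a)).
Proof.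
elim: m a => [|m IH] a /=; first exact: sqint_integrable.
rewrite (_ : _ \o _ = ((EFin \o (fun t => (\sum_(a <= k < a + 2 ^ m.+1) X k t) ^+ 2)%R) \+
   (EFin \o (fun t => dyadic_energy (X^~ t) m a)) \+
   (EFin \o (fun t => dyadic_energy (X^~ t) m (a + 2 ^ m))))%E).
  apply: integrableD => //; apply: integrableD => //.
  by apply: sqint_integrable; apply: sqint_sum.
by apply/funext => t /=; rewrite -!EFinD.
Qed.

Lemma block_sum_variance a n :
  \int[P]_t (\sum_(a <= k < a + n) X k t) ^+ 2 =
  \sum_(a <= k < a + n) \int[P]_t (X k t ^+ 2).
Proof.
elim: n => [|n IH].
  rewrite addn0 [RHS]big_geq//; under eq_Rintegral do rewrite big_geq// expr0n/=.
  by rewrite Rintegral_cst// mul0r.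
rewrite addnS [RHS]big_nat_recr ?leq_addr//= -IH.
pose S t := \sum_(a <= k < a + n) X k t.
have sS : sqint P S by exact: sqint_sum.
have SX : \int[P]_t (S t * X (a + n)%N t) = 0.
  rewrite /S; under eq_Rintegral do rewrite mulr_suml.
  rewrite Rintegral_sum => [|i]; last exact: sqint_mul.
  by rewrite big_nat big1// => i /andP[_ ia]; exact: X_orth.
have iSX := sqint_mul sS (X_sqint (a + n)%N).
transitivity (\int[P]_t ((S t ^+ 2 + 2 * (S t * X (a + n)%N t)) + X (a + n)%N t ^+ 2)).
  apply: eq_Rintegral => t _; rewrite big_nat_recr ?leq_addr//= -/(S t); ring.
have i2 : P.-integrable setT (EFin \o (fun t => 2 * (S t * X (a + n)%N t))).
  rewrite (_ : _ \o _ = (fun t => 2%:E * (EFin \o (fun t => S t * X (a + n)%N t)%R) t)%E).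
    exact: integrableZl.
  by apply/funext.
have i1 := sqint_integrable sS.
rewrite RintegralD//; last 2 first.
- rewrite (_ : _ \o _ = ((EFin \o (fun t => S t ^+ 2)%R) \+
     (EFin \o (fun t => 2 * (S t * X (a + n)%N t))%R))%E); first exact: integrableD.
  by apply/funext.
- exact: sqint_integrable.
by rewrite RintegralD// RintegralZl// SX mulr0 addr0.
Qed.

(** The blocks of one scale partition the index range, so by orthogonality their expected squares
    add up to the same total variance on each of the [m + 1] scales. *)
Lemma energy_expectation m a :
  \int[P]_t dyadic_energy (X^~ t) m a <=
  m.+1%:R * \sum_(a <= k < a + 2 ^ m) \int[P]_t (X k t ^+ 2).
Proof.
elim: m a => [|m IH] a.
  by rewrite expn0 addn1 big_nat1 mul1r.
have iE := energy_integrable m.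
have iS : P.-integrable setT
    (EFin \o (fun t => (\sum_(a <= k < a + 2 ^ m.+1) X k t) ^+ 2)).
  by apply: sqint_integrable; apply: sqint_sum.
rewrite [leLHS]/= RintegralD//; last first.
  rewrite (_ : _ \o _ = ((EFin \o (fun t => (\sum_(a <= k < a + 2 ^ m.+1) X k t) ^+ 2)%R) \+
    (EFin \o (fun t => dyadic_energy (X^~ t) m a)%R))%E); first exact: integrableD.
  by apply/funext.
rewrite RintegralD// block_sum_variance -natr1 mulrDl mul1r.
have -> : (a + 2 ^ m.+1 = a + 2 ^ m + 2 ^ m)%N by rewrite expnS mul2n -addnn addnA.
rewrite [X in _ <= _ * X + _](big_cat_nat (n := (a + 2 ^ m)%N)) ?leq_addr//=.
by have := IH a; have := IH (a + 2 ^ m)%N; rewrite mulrDr; lra.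
Qed.

(** Unbounded variances are allowed because the truncated thinning terms have them. With this bound
    the energy at scale [m] has expectation at most [C (m + 1) 3^m]. *)
Theorem orthogonal_slln (C : R) :
  (forall m k, (k < 2 ^ m)%N -> \int[P]_t (X k t ^+ 2) <= C * (3 / 2) ^+ m) ->
  {ae P, forall t, sublinear (fun n => \sum_(k < n) X k t)}.
Proof.
move=> XC.
have C0 : 0 <= C.
  have := XC 0%N 0%N isT; rewrite expr0 mulr1; apply: le_trans.
  by apply: Rintegral_ge0 => t _; exact: sqr_ge0.
have : {ae P, forall t, exists K : R, forall m,
    dyadic_energy (X^~ t) m 0 <= K * (15 / 4) ^+ m}.
  (* [31/10 = 3 * 31/30] absorbs the factor [m + 1]; the pathwise ratio [15/4] lies above it and
     still satisfies [15/4 * 31/30 < 4]. *)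
  apply: (@ae_geometric_bound _ _ _ _ _ (30%:R * C) _ (31 / 10)); try lra.
  - by move=> m; apply/measurable_EFinP; exact: measurable_int (energy_integrable m 0).
  - by move=> m t; exact: dyadic_energy_ge0.
  move=> m; rewrite fin_Rintegral; last exact: energy_integrable.
  rewrite lee_fin (le_trans (energy_expectation _ _))// add0n.
  apply: (@le_trans _ _ (m.+1%:R * (2 ^+ m * (C * (3 / 2) ^+ m)))).
    rewrite ler_wpM2l// big_nat.
    apply: (@le_trans _ _ (\sum_(0 <= k < 2 ^ m) C * (3 / 2) ^+ m)).
      by rewrite [leRHS]big_nat; apply: ler_sum => k /andP[_ km]; exact: XC.
    by rewrite sumr_const_nat subn0 -[leLHS]mulr_natl natrX.
  have -> : 30%:R * C * (31 / 10) ^+ m =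
      (30%:R * (31 / 30) ^+ m) * (2 ^+ m * (C * (3 / 2) ^+ m)) :> R.
    have -> : 31 / 10 = (31 / 30) * (2 * (3 / 2)) :> R by field.
    by rewrite !exprMn; ring.
  apply: ler_wpM2r; last exact: natr_le_geometric.
  by rewrite !mulr_ge0// exprn_ge0//; lra.
by apply: filterS => t [K /sublinear_of_energy].
Qed.

End orthogonal_slln.
(** * Independence of one coordinate from all the others *)

Section independent_pair.
Context {d d1 d2 : measure_display} {T : measurableType d}
  {T1 : measurableType d1} {T2 : measurableType d2} {R : realType}.
Variables (P : probability T R) (U : T -> T1) (V : T -> T2).
Context (mU : measurable_fun setT U) (mV : measurable_fun setT V).
Context (indepUV : forall A B, measurable A -> measurable B ->
  P (U @^-1` A `&` V @^-1` B) = (P (U @^-1` A) * P (V @^-1` B))%E).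

(** The joint law agrees with the product of the marginal laws on rectangles, hence everywhere, and
    Tonelli's theorem factors the integral. *)
Lemma ge0_integral_indepM (f : T1 -> R) (g : T2 -> R) :
  measurable_fun setT f -> measurable_fun setT g ->
  (forall x, 0 <= f x) -> (forall y, 0 <= g y) ->
  (\int[P]_t (f (U t) * g (V t))%:E =
   \int[P]_t (f (U t))%:E * \int[P]_t (g (V t))%:E)%E.
Proof.
move=> mf mg f0 g0.
have mUV : measurable_fun setT (fun t => (U t, V t)) by exact: measurable_fun_pair.
pose U' : {mfun T >-> T1} := HB.pack U (isMeasurableFun.Build _ _ _ _ U mU).
pose V' : {mfun T >-> T2} := HB.pack V (isMeasurableFun.Build _ _ _ _ V mV).
pose W' : {mfun T >-> (T1 * T2)%type} :=
  HB.pack (fun t => (U t, V t)) (isMeasurableFun.Build _ _ _ _ _ mUV).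
pose F (z : T1 * T2) : \bar R := (f z.1 * g z.2)%:E.
have mF : measurable_fun setT F.
  apply/measurable_EFinP; apply: measurable_funM.
    by apply: measurableT_comp => //; exact: measurable_fst.
  by apply: measurableT_comp => //; exact: measurable_snd.
have F0 z : (0 <= F z)%E by rewrite lee_fin mulr_ge0.
transitivity (\int[distribution P W']_z F z)%E.
  by rewrite ge0_integral_distribution.
rewrite (eq_measure_integral (distribution P U' \x distribution P V')%E); last first.
  by move=> A mA _; apply/esym/product_measure_unique.
rewrite fubini_tonelli1// /fubini_F /F /=.
transitivity (\int[distribution P U']_x ((f x)%:E * \int[P]_t (g (V t))%:E))%E.
  apply: eq_integral => x _; under eq_integral do rewrite EFinM.
  rewrite ge0_integralZl//; last 3 first.
  - exact/measurable_EFinP.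
  - by move=> y _; rewrite lee_fin.
  - by rewrite lee_fin.
  by rewrite ge0_integral_distribution//; apply/measurable_EFinP.
rewrite ge0_integralZr//; last 3 first.
- exact/measurable_EFinP.
- by move=> x _; rewrite lee_fin.
- by apply: integral_ge0 => t _; rewrite lee_fin.
by rewrite ge0_integral_distribution//; apply/measurable_EFinP.
Qed.

Lemma integrable_indepM (f : T1 -> R) (g : T2 -> R) :
  measurable_fun setT f -> measurable_fun setT g ->
  P.-integrable setT (fun t => (f (U t))%:E) ->
  P.-integrable setT (fun t => (g (V t))%:E) ->
  P.-integrable setT (fun t => (f (U t) * g (V t))%:E).
Proof.
move=> mf mg /integrableP[_ If] /integrableP[_ Ig]; apply/integrableP; split.
  apply/measurable_EFinP; apply: measurable_funM; exact: measurableT_comp.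
under eq_integral do rewrite EFinM abseM -EFinM.
rewrite (ge0_integral_indepM (f := fun x => `|f x|) (g := fun x => `|g x|))//.
- by rewrite lte_mul_pinfty// ?ge0_fin_numE//; apply: integral_ge0 => t _; rewrite lee_fin.
- exact: measurableT_comp.
- exact: measurableT_comp.
Qed.

Lemma Rintegral_indepM (f : T1 -> R) (g : T2 -> R) :
  measurable_fun setT f -> measurable_fun setT g ->
  P.-integrable setT (fun t => (f (U t))%:E) ->
  P.-integrable setT (fun t => (g (V t))%:E) ->
  \int[P]_t (f (U t) * g (V t)) = \int[P]_t f (U t) * \int[P]_t g (V t).
Proof.
move=> mf mg If Ig.
have mUf : measurable_fun setT (fun t => f (U t)) by exact: measurableT_comp.
have mVg : measurable_fun setT (fun t => g (V t)) by exact: measurableT_comp.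
(* The factorisation is known for nonnegative functions, so both factors are split into positive and
   negative parts and the four products are treated separately. *)
pose pos (x : R) := Num.max x 0; pose neg (x : R) := Num.max (- x) 0.
have posneg x : pos x - neg x = x.
  by rewrite /pos /neg; case: (leP x 0) => x0; case: (leP (- x) 0) => x1; lra.
have pos0 x : 0 <= pos x by rewrite /pos le_max lexx orbT.
have neg0 x : 0 <= neg x by rewrite /neg le_max lexx orbT.
have mpos : measurable_fun setT pos by exact: measurable_maxr.
have mneg : measurable_fun setT neg.
  by apply: measurable_maxr => //; exact: measurable_funN.
have posle x : `|pos x| <= `|x|.
  by rewrite ger0_norm// /pos ge_max ler_norm normr_ge0.
have negle x : `|neg x| <= `|x|.
  by rewrite ger0_norm// /neg ge_max normr_ge0 -normrN ler_norm.
have Ile (h h' : T -> R) : P.-integrable setT (EFin \o h) ->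
    measurable_fun setT h' -> (forall t, `|h' t| <= `|h t|) ->
    P.-integrable setT (EFin \o h').
  move=> Ih mh' hh'; apply: le_integrable Ih => //; first exact/measurable_EFinP.
  by move=> t _; rewrite lee_fin.
have ia (a : R -> R) : measurable_fun setT a -> (forall x, `|a x| <= `|x|) ->
    P.-integrable setT (EFin \o (fun t => a (f (U t)))).
  move=> ma ale; apply: (Ile (fun t => f (U t))) => //.
  exact: (measurableT_comp ma mUf).
have ib (a : R -> R) : measurable_fun setT a -> (forall x, `|a x| <= `|x|) ->
    P.-integrable setT (EFin \o (fun t => a (g (V t)))).
  move=> ma ale; apply: (Ile (fun t => g (V t))) => //.
  exact: (measurableT_comp ma mVg).
have ge0E (a b : R -> R) : measurable_fun setT a -> measurable_fun setT b ->
    (forall x, 0 <= a x) -> (forall x, 0 <= b x) ->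
    (forall x, `|a x| <= `|x|) -> (forall x, `|b x| <= `|x|) ->
    \int[P]_t (a (f (U t)) * b (g (V t))) =
    \int[P]_t a (f (U t)) * \int[P]_t b (g (V t)).
  move=> ma mb a0 b0 ale ble.
  rewrite /Rintegral (ge0_integral_indepM (f := a \o f) (g := b \o g)); [|
    exact: measurableT_comp|exact: measurableT_comp|by move=> x /=|by move=> x /=].
  by rewrite fineM//; apply: integrable_fin_num => //; [exact: ia|exact: ib].
have iab (a b : R -> R) : measurable_fun setT a -> measurable_fun setT b ->
    (forall x, `|a x| <= `|x|) -> (forall x, `|b x| <= `|x|) ->
    P.-integrable setT (EFin \o (fun t => a (f (U t)) * b (g (V t)))).
  move=> ma mb ale ble; apply: Ile (integrable_indepM mf mg If Ig) _ _.
    by apply: measurable_funM; [exact: (measurableT_comp ma mUf)|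
      exact: (measurableT_comp mb mVg)].
  by move=> t; rewrite !normrM ler_pM.
transitivity (\int[P]_t ((pos (f (U t)) * pos (g (V t)) - pos (f (U t)) * neg (g (V t)))
   - (neg (f (U t)) * pos (g (V t)) - neg (f (U t)) * neg (g (V t))))).
  by apply: eq_Rintegral => t _; rewrite -[in LHS](posneg (f (U t)))
    -[in LHS](posneg (g (V t))); ring.
have iB (h h' : T -> R) : P.-integrable setT (EFin \o h) ->
   P.-integrable setT (EFin \o h') -> P.-integrable setT (EFin \o (fun t => h t - h' t)).
  move=> i1 i2; rewrite (_ : _ \o _ = (EFin \o h) \- (EFin \o h'))%E.
    exact: integrableB.
  by apply/funext.
rewrite RintegralB//; [|by apply: iB; exact: iab|by apply: iB; exact: iab].
rewrite !RintegralB//; try exact: iab.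
rewrite !ge0E//.
under [in RHS]eq_Rintegral do rewrite -(posneg (f (U _))).
rewrite RintegralB//; try exact: ia.
under [X in _ = _ * X]eq_Rintegral do rewrite -(posneg (g (V _))).
rewrite RintegralB//; try exact: ib.
ring.
Qed.

End independent_pair.
Lemma bigsetI_seqE {T : Type} {I : eqType} (J : seq I) (F : I -> set T) :
  \big[setI/setT]_(j <- J) F j = [set t | forall j, j \in J -> F j t].
Proof.
elim: J => [|i J IH]; first by rewrite big_nil; apply/seteqP; split.
rewrite big_cons IH; apply/seteqP; split => [t [Fi FJ] j|t h].
  by rewrite inE => /predU1P[->//|]; exact: FJ.
by split=> [|j jJ]; apply: h; rewrite inE ?eqxx// jJ orbT.
Qed.

(** * The sigma-algebra generated by all other coordinates *)

Section others.
Context {d : measure_display} {T : measurableType d} {R : realType} {I : eqType}.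
Variables (P : probability T R) (X : I -> T -> nat).

Definition other_cylinders (i : I) : set (set T) :=
  [set A | exists (J : seq I) (B : I -> set nat), [/\ uniq J, i \notin J &
    A = \big[setI/setT]_(j <- J) (X j @^-1` B j)]].

(** A copy of [T] carrying a coarser sigma-algebra: measurability of [H : others i -> _] expresses
    that [H] does not depend on coordinate [i]. As a type it lets the identity map [T -> others i]
    play the role of one member of an independent pair. *)
Definition others (i : I) := g_sigma_algebraType (other_cylinders i).

Context (mX : forall i (B : set nat), measurable (X i @^-1` B)).
Context (indX : mutually_independent P X).

Lemma setI_closed_other_cylinders i : setI_closed (other_cylinders i).
Proof.
move=> _ _ [J1 [B1 [u1 i1 ->]]] [J2 [B2 [u2 i2 ->]]].
(* An index may occur in both lists; it is kept once, with both constraints. *)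
exists (undup (J1 ++ J2)), (fun j => [set n | (j \in J1 -> B1 j n) /\ (j \in J2 -> B2 j n)]).
split; [exact: undup_uniq|by rewrite mem_undup mem_cat negb_or i1|].
rewrite !bigsetI_seqE; apply/seteqP; split => [t [h1 h2] j|t h].
  rewrite /= mem_undup mem_cat => /orP[] jJ; split => jJ'.
  - exact: h1.
  - exact: h2.
  - exact: h1.
  - exact: h2.
split=> j /= jJ; have := h j; rewrite /= mem_undup mem_cat jJ ?orbT => /(_ isT)[].
  by move=> /(_ isT).
by move=> _ /(_ isT).
Qed.

Lemma measurable_others i (A : set T) :
  measurable (A : set (others i)) -> measurable A.
Proof.
apply: smallest_sub; first exact: sigma_algebra_measurable.
move=> _ [J [B [_ _ ->]]].
by apply: bigsetI_measurable => j _; exact: mX.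
Qed.

Lemma measurable_fun_others d' (T' : measurableType d') i (H : T -> T') :
  measurable_fun setT (H : others i -> T') -> measurable_fun setT H.
Proof.
by move=> mH _ B mB; apply: measurable_others (mH measurableT B mB).
Qed.

Lemma others_coordinate i j (B : set nat) : j != i ->
  measurable (X j @^-1` B : set (others i)).
Proof.
move=> ji; apply: sub_sigma_algebra; exists [:: j], (fun=> B).
by split => //; [rewrite inE eq_sym|rewrite big_seq1].
Qed.

Lemma others_indep i (A : set T) (B : set nat) :
  measurable (A : set (others i)) -> P (A `&` X i @^-1` B) = (P A * P (X i @^-1` B))%E.
Proof.
pose H := [set A | measurable A /\ P (A `&` X i @^-1` B) = (P A * P (X i @^-1` B))%E].
suff : <<s other_cylinders i >> `<=` H by move=> + mA => /(_ A mA) [].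
have mB : measurable (X i @^-1` B) by exact: mX.
have PBfin : P (X i @^-1` B) \is a fin_num by exact: fin_num_measure.
have Plty (A' : set T) : measurable A' -> (P A' < +oo)%E.
  by move=> mA'; rewrite -ge0_fin_numE//; exact: fin_num_measure.
apply: lambda_system_subset.
- exact: setI_closed_other_cylinders.
- split => //.
  + by split => //; rewrite setTI probability_setT mul1e.
  + move=> A1 A2 A21 [m1 e1] [m2 e2]; split; first exact: measurableD.
    have -> : (A1 `\` A2) `&` X i @^-1` B =
        (A1 `&` X i @^-1` B) `\` (A2 `&` X i @^-1` B).
      apply/seteqP; split => t /=; first by move=> [[? ?] ?]; split => // -[].
      by move=> [[? ?] h]; split => //; split => // ?; apply: h.
    rewrite (measureD (measurableI _ _ m1 mB) (measurableI _ _ m2 mB)) ?Plty//; last first.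
      exact: measurableI.
    rewrite (measureD m1 m2) ?Plty//.
    have -> : A1 `&` X i @^-1` B `&` (A2 `&` X i @^-1` B) = A2 `&` X i @^-1` B.
      by apply/seteqP; split => t /=; [move=> [_ []]|move=> [a2 b]; split => //; split => //; exact: A21].
    have -> : A1 `&` A2 = A2 by exact: setIidr.
    transitivity (P A1 * P (X i @^-1` B) - P A2 * P (X i @^-1` B))%E.
      by congr (_ - _)%E.
    rewrite muleBl//.
    by rewrite fin_num_adde_defl// fin_numN; exact: fin_num_measure.
  + move=> F ndF HF; split; first by apply: bigcup_measurable => n _; exact: (HF n).1.
    rewrite setI_bigcupl.
    have c1 : P (F n `&` X i @^-1` B) @[n --> \oo] --> P (\bigcup_n (F n `&` X i @^-1` B)).
      apply: nondecreasing_cvg_mu.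
      * by move=> n; apply: measurableI => //; exact: (HF n).1.
      * by apply: bigcup_measurable => n _; apply: measurableI => //; exact: (HF n).1.
      * by move=> m n mn; apply/subsetPset; apply: setSI; apply/subsetPset/ndF.
    have c2 : P (F n) @[n --> \oo] --> P (\bigcup_n F n).
      apply: nondecreasing_cvg_mu => //; first by move=> n; exact: (HF n).1.
      by apply: bigcup_measurable => n _; exact: (HF n).1.
    have : (P (F n) * P (X i @^-1` B))%E @[n --> \oo] -->
        (P (\bigcup_n F n) * P (X i @^-1` B))%E by exact: cvgeZr.
    rewrite -(funext (fun n => (HF n).2)).
    by move/cvg_lim => <- //; apply/esym/cvg_lim.
- move=> _ [J [C [uJ iJ ->]]]; split.
    by apply: bigsetI_measurable => j _; exact: mX.
  (* Mutual independence takes a single family of sets, so [B] is grafted onto [C] at the index [i];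
     as [i] is not in [J], the sets along [J] are unchanged. *)
  have := @indX (i :: J) (fun j => if j == i then B else C j).
  rewrite /= iJ => /(_ uJ); rewrite !big_cons eqxx setIC => Ei.
  have E (r : seq I) : i \notin r ->
      \big[setI/setT]_(j <- r) (X j @^-1` (if j == i then B else C j)) =
      \big[setI/setT]_(j <- r) (X j @^-1` C j).
    move=> ir; apply: eq_big_seq => j jr; case: eqP => // ji.
    by move: ir; rewrite -ji jr.
  rewrite E// in Ei; rewrite Ei muleC; congr (_ * _)%E.
  rewrite (indX _ uJ); apply: eq_big_seq => j jJ; case: eqP => // ji.
  by move: iJ; rewrite -ji jJ.
- by [].
Qed.

Section innovation.
Variables (i : I) (g : nat -> R).
Context (sg : sqint P (g \o X i)).

Lemma measurable_coordinate : measurable_fun setT (X i : T -> nat).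
Proof. by move=> _ B _; rewrite setTI. Qed.

Let mid : measurable_fun setT (idfun : T -> others i).
Proof. by move=> _ B mB; rewrite setTI; exact: (@measurable_others i). Qed.

Let indid (A : set (others i)) (B : set nat) : measurable A -> measurable B ->
  P ((idfun : T -> others i) @^-1` A `&` X i @^-1` B) =
  (P ((idfun : T -> others i) @^-1` A) * P (X i @^-1` B))%E.
Proof. by move=> mA _; exact: others_indep. Qed.

(** A product of square integrable factors is in general only integrable. Independence of the
    squares gives it a second moment without any boundedness. *)
Lemma innovation_sqr (H : T -> R) :
  measurable_fun setT (H : others i -> R) -> sqint P H ->
  sqint P (fun t => g (X i t) * H t) /\
  \int[P]_t ((g (X i t) * H t) ^+ 2) =
    \int[P]_t (g (X i t) ^+ 2) * \int[P]_t (H t ^+ 2).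
Proof.
move=> mH sH.
have mg2 : measurable_fun setT (fun n => g n ^+ 2) by [].
have mX' := measurable_coordinate.
have mH2 : measurable_fun setT ((fun t => H t ^+ 2) : others i -> R).
  exact: measurable_funX.
have iH2 := sqint_integrable sH.
have ig2 := sqint_integrable sg.
have iM := integrable_indepM mid mX' indid (f := fun t => H t ^+ 2)
  (g := fun n => g n ^+ 2) mH2 mg2 iH2 ig2.
split.
  apply: sqint_of_integrable; first exact: measurable_funM sg.1 sH.1.
  apply: eq_integrable iM => // t _ /=; by rewrite exprMn mulrC.
rewrite -[RHS]mulrC -(Rintegral_indepM mid mX' indid (f := fun t => H t ^+ 2)
  (g := fun n => g n ^+ 2))//.
by apply: eq_Rintegral => t _; rewrite exprMn mulrC.
Qed.

Lemma innovation_mean (H : T -> R) :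
  measurable_fun setT (H : others i -> R) -> P.-integrable setT (EFin \o H) ->
  \int[P]_t (g (X i t) * H t) = \int[P]_t g (X i t) * \int[P]_t H t.
Proof.
move=> mH iH; have mX' := measurable_coordinate.
rewrite -[RHS]mulrC -(Rintegral_indepM mid mX' indid (f := H) (g := g))//.
  by apply: eq_Rintegral => t _; rewrite mulrC.
exact: sqint_integrable1 sg.
Qed.

(** Stated for extended integrals because it enters the second moment bound of the process, where
    finiteness is still to be proved. *)
Lemma ge0_innovation_mean (h : nat -> R) (H : T -> R) :
  (forall n, 0 <= h n) -> (forall t, 0 <= H t) ->
  measurable_fun setT (H : others i -> R) ->
  (\int[P]_t (h (X i t) * H t)%:E =
   \int[P]_t (h (X i t))%:E * \int[P]_t (H t)%:E)%E.
Proof.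
move=> h0 H0 mH; have mX' := measurable_coordinate.
rewrite -[RHS]muleC -(ge0_integral_indepM mid mX' indid (f := H) (g := h))//.
by apply: eq_integral => t _; rewrite mulrC.
Qed.

End innovation.

(** Term [k] collects several innovations, as thinning does. For two distinct pairs [(k, i)] and
    [(l, j)], ordered by time, the whole product for [(l, j)] and the weight [H k i] ignore
    coordinate [i], so the centring of [g i] kills the cross moment. This gives orthogonality
    between times and additivity of second moments within one time. *)
Lemma innovation_slln (J : nat -> seq I) (g : I -> nat -> R) (H : nat -> I -> T -> R)
    (C : R) :
  (forall k, uniq (J k)) ->
  (forall k i, i \in J k -> sqint P (g i \o X i)) ->
  (forall k i, i \in J k -> \int[P]_t g i (X i t) = 0) ->
  (forall k i, i \in J k -> measurable_fun setT (H k i : others i -> R)) ->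
  (forall k i, i \in J k -> sqint P (H k i)) ->
  (forall k l i j, i \in J k -> j \in J l -> (l < k)%N || (l == k) && (j != i) ->
    measurable_fun setT ((fun t => g j (X j t) * H l j t) : others i -> R)) ->
  (forall m k, (k < 2 ^ m)%N ->
    \sum_(i <- J k) \int[P]_t (g i (X i t) ^+ 2) * \int[P]_t (H k i t ^+ 2)
      <= C * (3 / 2) ^+ m) ->
  {ae P, forall t, sublinear (fun n =>
    \sum_(k < n) \sum_(i <- J k) g i (X i t) * H k i t)}.
Proof.
move=> uJ sg g0 mH sH mlt bound.
have sgH k i : i \in J k -> sqint P (fun t => g i (X i t) * H k i t).
  by move=> iJ; have [] := innovation_sqr (sg _ _ iJ) (mH _ _ iJ) (sH _ _ iJ).
have orth k l i j : i \in J k -> j \in J l -> (l < k)%N || (l == k) && (j != i) ->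
    \int[P]_t ((g i (X i t) * H k i t) * (g j (X j t) * H l j t)) = 0.
  move=> iJ jJ lk.
  have mHK : measurable_fun setT
      ((fun t => H k i t * (g j (X j t) * H l j t)) : others i -> R).
    by apply: measurable_funM; [exact: mH|exact: mlt lk].
  under eq_Rintegral do rewrite -mulrA.
  rewrite (innovation_mean (sg _ _ iJ) mHK).
    by rewrite (g0 _ _ iJ) mul0r.
  by apply: sqint_mul; [exact: sH|exact: sgH].
have sX k : sqint P (fun t => \sum_(i <- J k) g i (X i t) * H k i t).
  rewrite (_ : (fun t => _) = (fun t => \sum_(i <- J k | i \in J k) g i (X i t) * H k i t)).
    by apply: sqint_sum => i; exact: sgH.
  by apply/funext => t; rewrite big_seq.
have crossE k (Z : T -> R) : sqint P Z ->
    \int[P]_t ((\sum_(i <- J k) g i (X i t) * H k i t) * Z t) =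
    \sum_(i <- J k) \int[P]_t ((g i (X i t) * H k i t) * Z t).
  move=> sZ; under eq_Rintegral do rewrite mulr_suml.
  have {}sgH i : i \in J k -> sqint P (fun t => g i (X i t) * H k i t) by exact: sgH.
  elim: (J k) sgH => [|i r IH] sr.
    under eq_Rintegral do rewrite big_nil.
    by rewrite Rintegral_cst// mul0r big_nil.
  under eq_Rintegral do rewrite big_cons.
  have sr' j : j \in r -> sqint P (fun t => g j (X j t) * H k j t).
    by move=> jr; apply: sr; rewrite inE jr orbT.
  rewrite big_cons RintegralD//.
  - by rewrite IH.
  - by apply: sqint_mul => //; apply: sr; rewrite mem_head.
  rewrite (_ : _ \o _ = EFin \o (fun t =>
      (\sum_(j <- r | j \in r) g j (X j t) * H k j t) * Z t)).
    by apply: sqint_mul => //; apply: sqint_sum.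
  by apply/funext => t /=; rewrite -big_seq mulr_suml.
apply: (@orthogonal_slln _ _ _ P _ sX _ C) => [l k lk|m k km].
  under eq_Rintegral do rewrite mulrC.
  rewrite crossE// big_seq big1// => i iJ.
  under eq_Rintegral do rewrite mulrC.
  rewrite crossE; last exact: sgH.
  rewrite big_seq big1// => j jJ.
  by under eq_Rintegral do rewrite mulrC; apply: orth => //; rewrite lk.
apply: le_trans (bound m k km).
under eq_Rintegral do rewrite expr2.
rewrite crossE// big_seq [leRHS]big_seq; apply: ler_sum => i iJ.
under eq_Rintegral do rewrite mulrC.
rewrite crossE; last exact: sgH.
rewrite (bigD1_seq i)//= big_seq_cond big1 => [|j /andP[jJ ji]].
  rewrite addr0; under eq_Rintegral do rewrite -expr2.
  by have [_ ->] := innovation_sqr (sg _ _ iJ) (mH _ _ iJ) (sH _ _ iJ).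
by apply: orth => //; rewrite eqxx eq_sym ji orbT.
Qed.

End others.
(** * The INAR(1) process with two innovational outliers *)

Section discrete_measurability.
Context {d d' : measure_display} {T : measurableType d} {V : measurableType d'}.

(** A countable partition by the value of [f]; it handles sums whose number of terms is random. *)
Lemma measurable_fun_select (f : T -> nat) (F : nat -> T -> V) :
  measurable_fun setT f -> (forall n, measurable_fun setT (F n)) ->
  measurable_fun setT (fun t => F (f t) t).
Proof.
move=> mf mF _ B mB; rewrite setTI.
have -> : (fun t => F (f t) t) @^-1` B =
    \bigcup_n (f @^-1` [set n] `&` F n @^-1` B).
  by apply/seteqP; split => [t Bt|t [n _ [/= -> ]]//]; exists (f t).
apply: bigcup_measurable => n _; apply: measurableI.
  by rewrite -[X in measurable X]setTI; exact: mf.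
by rewrite -[X in measurable X]setTI; exact: mF.
Qed.

Lemma measurable_fun_nat_comp (f : T -> nat) (h : nat -> V) :
  measurable_fun setT f -> measurable_fun setT (fun t => h (f t)).
Proof. by move=> mf; apply: (measurableT_comp (f := h)). Qed.

End discrete_measurability.

Section inar_paths.
Context {d : measure_display} {T : measurableType d}.
Implicit Types f g : T -> nat.

Lemma measurable_fun_addn f g :
  measurable_fun setT f -> measurable_fun setT g ->
  measurable_fun setT (fun t => (f t + g t)%N).
Proof.
move=> mf mg; apply: (measurable_fun_select (F := fun n t => (n + g t)%N)) => // n.
exact: (measurable_fun_nat_comp (addn n)).
Qed.

Lemma measurable_survivors f (x : nat -> T -> nat) :
  measurable_fun setT f -> (forall j, measurable_fun setT (x j.+1)) ->
  measurable_fun setT (fun t => (\sum_(1 <= j < (f t).+1) x j t)%N).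
Proof.
move=> mf mx.
apply: (measurable_fun_select (F := fun n t => (\sum_(1 <= j < n.+1) x j t)%N)) => // n.
elim: n => [|n IHn].
  rewrite (_ : (fun t => _) = fun=> 0%N) //.
  by apply/funext => t; rewrite big_geq.
rewrite (_ : (fun t => _) = fun t => (\sum_(1 <= j < n.+1) x j t + x n.+1 t)%N).
  by apply: measurable_fun_addn => //; exact: mx.
by apply/funext => t; rewrite big_nat_recr.
Qed.

(** Measurability is asked only of the innovations up to time [k], and [T] is arbitrary, so that the
    lemma also applies on [others i] when [i] is a later innovation. *)
Lemma measurable_inar (y0 : T -> nat) (eps : nat -> T -> nat)
    (xi : nat -> nat -> T -> nat) (s1 s2 th1 th2 k : nat) :
  measurable_fun setT y0 ->
  (forall l, (l < k)%N -> measurable_fun setT (eps l.+1)) ->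
  (forall l j, (l < k)%N -> measurable_fun setT (xi l.+1 j.+1)) ->
  measurable_fun setT (fun t =>
    inar (y0 t) (fun k => eps k t) (fun k j => xi k j t) s1 s2 th1 th2 k).
Proof.
move=> my0; elim: k => [//|k IH] meps mxi /=.
have mY : measurable_fun setT (fun t =>
    inar (y0 t) (fun k => eps k t) (fun k j => xi k j t) s1 s2 th1 th2 k).
  by apply: IH => [l lk|l j lk]; [apply: meps|apply: mxi]; rewrite ltnS ltnW.
do 2![apply: measurable_fun_addn; last exact: measurable_cst].
apply: measurable_fun_addn; last exact: meps.
by apply: measurable_survivors => // j; exact: mxi.
Qed.

End inar_paths.

Lemma inarS (y0 : nat) (eps : nat -> nat) (xi : nat -> nat -> nat)
    (s1 s2 th1 th2 k : nat) (y := inar y0 eps xi s1 s2 th1 th2) :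
  y k.+1 = (\sum_(1 <= j < (y k).+1) xi k.+1 j + eps k.+1
    + (if k.+1 == s1 then th1 else 0) + (if k.+1 == s2 then th2 else 0))%N.
Proof. by []. Qed.

Lemma le_inar (y0 : nat) (eps : nat -> nat) (xi xi' : nat -> nat -> nat)
    (s1 s2 th1 th2 k : nat) :
  (forall k j, (xi' k.+1 j.+1 <= xi k.+1 j.+1)%N) ->
  (inar y0 eps xi' s1 s2 th1 th2 k <= inar y0 eps xi s1 s2 th1 th2 k)%N.
Proof.
move=> le_xi; elim: k => //= k IH; rewrite !leq_add2r !big_add1/=.
apply: (@leq_trans (\sum_(0 <= j < inar y0 eps xi' s1 s2 th1 th2 k) xi k.+1 j.+1)).
  exact: leq_sum.
by rewrite [leqRHS](big_cat_nat (leq0n _) IH)/= leq_addr.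
Qed.

Lemma eq_inar (y0 : nat) (eps : nat -> nat) (xi xi' : nat -> nat -> nat)
    (s1 s2 th1 th2 k : nat) :
  (forall l j, (l < k)%N -> xi l.+1 j.+1 = xi' l.+1 j.+1) ->
  inar y0 eps xi s1 s2 th1 th2 k = inar y0 eps xi' s1 s2 th1 th2 k.
Proof.
elim: k => //= k IH E; rewrite IH => [|l j lk]; last by rewrite E// ltnS ltnW.
by congr (_ + _ + _ + _)%N; rewrite !big_add1/=; apply: eq_bigr => j _; exact: E.
Qed.

(** * Equality of integrals for identically distributed variables *)

Section identical_laws.
Context {d : measure_display} {T : measurableType d} {R : realType}.
Variables (P : probability T R) (V V' : T -> nat).
Context (mV : measurable_fun setT V) (mV' : measurable_fun setT V').
Context (VV' : forall B : set nat, P (V @^-1` B) = P (V' @^-1` B)).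

Lemma ge0_integral_same_law (h : nat -> R) : (forall n, 0 <= h n) ->
  (\int[P]_t (h (V t))%:E = \int[P]_t (h (V' t))%:E)%E.
Proof.
move=> h0.
pose U : {mfun T >-> nat} := HB.pack V (isMeasurableFun.Build _ _ _ _ V mV).
pose U' : {mfun T >-> nat} := HB.pack V' (isMeasurableFun.Build _ _ _ _ V' mV').
rewrite -(@ge0_integral_distribution _ _ _ _ _ P U (fun n => (h n)%:E))//.
rewrite -(@ge0_integral_distribution _ _ _ _ _ P U' (fun n => (h n)%:E))//.
by apply: eq_measure_integral => A mA _; exact: VV'.
Qed.

Lemma integral_same_law (h : nat -> R) :
  P.-integrable setT (fun t => (h (V t))%:E) ->
  P.-integrable setT (fun t => (h (V' t))%:E) ->
  (\int[P]_t (h (V t))%:E = \int[P]_t (h (V' t))%:E)%E.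
Proof.
move=> ih ih'.
pose U : {mfun T >-> nat} := HB.pack V (isMeasurableFun.Build _ _ _ _ V mV).
pose U' : {mfun T >-> nat} := HB.pack V' (isMeasurableFun.Build _ _ _ _ V' mV').
rewrite -(@integral_distribution _ _ _ _ _ P U (fun n => (h n)%:E))//.
rewrite -(@integral_distribution _ _ _ _ _ P U' (fun n => (h n)%:E))//.
by apply: eq_measure_integral => A mA _; exact: VV'.
Qed.

End identical_laws.

(** * Moments and growth of the process *)

Section inar_process.
Context {d : measure_display} {T : measurableType d} {R : realType}.
Variables (P : probability T R) (alpha mu : R).
Variables (eps : nat -> T -> nat) (xi : nat -> nat -> T -> nat) (Y0 : T -> nat).
Variables (s1 s2 th1 th2 : nat).
Context (alpha01 : 0 < alpha < 1).
Context (meps : forall k (B : set nat), measurable (eps k.+1 @^-1` B)).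
Context (mxi : forall k j (B : set nat), measurable (xi k.+1 j.+1 @^-1` B)).
Context (mY0 : forall B : set nat, measurable (Y0 @^-1` B)).
Context (xi_le1 : forall k j t, (xi k.+1 j.+1 t <= 1)%N).
Context (ind : mutually_independent P (inar_family eps xi Y0)).
Context (eps_law : forall k (B : set nat),
  P (eps k.+1 @^-1` B) = P (eps 1%N @^-1` B)).
Context (xi_law : forall k j, P (xi k.+1 j.+1 @^-1` [set 1%N]) = alpha%:E).
Context (eps2 : (\int[P]_t (((eps 1%N t)%:R : R) ^+ 2)%:E < +oo)%E).
Context (Y02 : (\int[P]_t (((Y0 t)%:R : R) ^+ 2)%:E < +oo)%E).
Context (eps_mean : (\int[P]_t (((eps 1%N t)%:R : R))%:E = mu%:E)%E).

Local Notation Fam := (inar_family eps xi Y0).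
Local Notation epsI k := (inl (inl k) : (nat + (nat * nat)) + unit).
Local Notation xiI k j := (inl (inr (k, j)) : (nat + (nat * nat)) + unit).
Let Y k t := inar (Y0 t) (fun k => eps k t) (fun k j => xi k j t) s1 s2 th1 th2 k.

Let mFam i (B : set nat) : measurable (Fam i @^-1` B).
Proof. by case: i => [[k|[k j]]|[]] /=. Qed.

Let mfFam i : measurable_fun setT (Fam i : T -> nat).
Proof. by move=> _ B _; rewrite setTI. Qed.

Lemma measurable_coordinate_others i j : j != i ->
  measurable_fun setT (Fam j : others Fam i -> nat).
Proof. by move=> ji _ B _; rewrite setTI; exact: others_coordinate. Qed.

(** Index [l] of [inar_family] stands for time [l.+1], so [k <= l] selects the innovations acting
    strictly after time [k]. *)
Definition innovation_after (k : nat) (i : (nat + (nat * nat)) + unit) : bool :=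
  match i with
  | inl (inl l) => (k <= l)%N
  | inl (inr (l, _)) => (k <= l)%N
  | inr _ => false
  end.

Lemma measurable_Y_others k i : innovation_after k i ->
  measurable_fun setT (Y k : others Fam i -> nat).
Proof.
move=> ki; apply: (@measurable_inar _ (others Fam i) Y0 eps xi) => [|l lk|l j lk].
- apply: (@measurable_coordinate_others i (inr tt)).
  by apply: contraL ki => /eqP <-.
- apply: (@measurable_coordinate_others i (epsI l)).
  by apply: contraL ki => /eqP <- /=; rewrite -ltnNge.
- apply: (@measurable_coordinate_others i (xiI l j)).
  by apply: contraL ki => /eqP <- /=; rewrite -ltnNge.
Qed.

Lemma measurable_Y k : measurable_fun setT (Y k).
Proof.
apply: (measurable_fun_others mFam (i := epsI k)).
exact: (@measurable_Y_others k (epsI k) (leqnn k)).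
Qed.

Lemma measurable_thinning k :
  measurable_fun setT (fun t => (\sum_(1 <= j < (Y k t).+1) xi k.+1 j t)%N).
Proof.
apply: measurable_survivors; first exact: measurable_Y.
by move=> j; exact: (mfFam (xiI k j)).
Qed.

Lemma xi_idem k j t : (xi k.+1 j.+1 t)%:R ^+ 2 = (xi k.+1 j.+1 t)%:R :> R.
Proof. by case: (xi _ _ _) (xi_le1 k j t) => [|[|//]] _; rewrite ?expr0n ?expr1n. Qed.

Lemma xi_mean k j : (\int[P]_t ((xi k.+1 j.+1 t)%:R)%:E = alpha%:E)%E.
Proof.
rewrite -(xi_law k j) -[X in P X]setIT -integral_indic//.
apply: eq_integral => t _; rewrite indicE; congr (_%:R)%:E.
case E : (xi k.+1 j.+1 t) (xi_le1 k j t) => [|[|//]] _.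
  by rewrite memNset//= E.
by rewrite mem_set.
Qed.

Lemma thinning_le k (y : nat) t :
  (\sum_(1 <= j < y.+1) xi k.+1 j t <= y)%N.
Proof.
rewrite big_add1/= -[leqRHS]subn0 -[leqRHS]muln1 -sum_nat_const_nat.
by apply: leq_sum => j _.
Qed.

(* The square of the number of survivors is at most the population times the
   number of survivors; only its conditional mean is then needed. *)
Lemma thinning_second_moment k :
  (\int[P]_t (((\sum_(1 <= j < (Y k t).+1) xi k.+1 j t)%N%:R : R) ^+ 2)%:E <=
   alpha%:E * \int[P]_t (((Y k t)%:R : R) ^+ 2)%:E)%E.
Proof.
(* The indicator [j < Y k] turns the random sum of survivors into a series over all [j], where
   Tonelli applies and each weight [v j] is independent of the particle it multiplies. *)
pose v j t : R := (Y k t)%:R * (j < Y k t)%:R.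
pose u j t : \bar R := ((xi k.+1 j.+1 t)%:R * v j t)%:E.
have v0 j t : 0 <= v j t by rewrite mulr_ge0.
have u0 j t : (0 <= u j t)%E by rewrite lee_fin mulr_ge0.
have mvo j : measurable_fun setT (v j : others Fam (xiI k j) -> R).
  apply: (measurable_fun_nat_comp (fun n => n%:R * (j < n)%:R : R)).
  exact: (@measurable_Y_others k (xiI k j) (leqnn k)).
have mv j : measurable_fun setT (v j) by apply: (measurable_fun_others mFam (mvo j)).
have mu' j : measurable_fun setT (u j).
  apply/measurable_EFinP/measurable_funM => //.
  by apply: (measurable_fun_nat_comp (fun n => n%:R : R)); exact: (mfFam (xiI k j)).
have tail (a : nat -> R) t : (forall j, 0 <= a j) -> (forall j, (Y k t <= j)%N -> a j = 0) ->
    (\sum_(j <oo) (a j)%:E = (\sum_(0 <= j < Y k t) a j)%:E)%E.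
  move=> a0 aY; rewrite (nneseries_split 0 (Y k t)); last by move=> j _; rewrite lee_fin.
  rewrite add0n [X in (_ + X)%E]eseries0 ?adde0 ?sumEFin// => j jY _.
  by rewrite aY.
have uE t : (\sum_(j <oo) u j t =
    ((Y k t)%:R * (\sum_(1 <= j < (Y k t).+1) xi k.+1 j t)%N%:R)%:E)%E.
  rewrite (tail (fun j => (xi k.+1 j.+1 t)%:R * v j t) t) => [|j|j Yj]; last 2 first.
  - by rewrite mulr_ge0.
  - by rewrite /v ltnNge Yj/= !mulr0.
  rewrite big_add1/= natr_sum mulr_sumr; congr EFin.
  by rewrite !big_nat; apply: eq_bigr => j /andP[_ jY]; rewrite /v jY mulr1 mulrC.
have vE t : (\sum_(j <oo) (v j t)%:E = ((Y k t)%:R ^+ 2)%:E)%E.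
  rewrite (tail (v^~ t) t) => [|//|j Yj]; last by rewrite /v ltnNge Yj mulr0.
  rewrite big_nat (eq_bigr (fun=> (Y k t)%:R)) => [|j /andP[_ jY]]; last first.
    by rewrite /v jY mulr1.
  by rewrite -big_nat sumr_const_nat subn0 expr2 mulr_natr.
apply: (@le_trans _ _ (\int[P]_t (\sum_(j <oo) u j t)))%E.
  apply: ge0_le_integral => //.
  - apply/measurable_EFinP/measurable_funX.
    exact: (measurable_fun_nat_comp (fun n => n%:R : R) (measurable_thinning k)).
  - by apply: ge0_emeasurable_sum.
  - move=> t _; rewrite uE lee_fin expr2 ler_wpM2r// ler_nat.
    exact: thinning_le.
rewrite integral_nneseries//.
under eq_eseriesr => j _.
  rewrite (ge0_innovation_mean mFam ind (i := xiI k j) (h := fun n => n%:R))//.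
  rewrite xi_mean.
  over.
rewrite nneseriesZl; last by move=> j _; apply: integral_ge0 => t _; rewrite lee_fin.
rewrite -integral_nneseries//; last 2 first.
- by move=> j; apply/measurable_EFinP.
- by move=> j t _; rewrite lee_fin.
by under eq_integral do rewrite vE.
Qed.
Lemma eps_integral k (h : nat -> R) : (forall n, 0 <= h n) ->
  (\int[P]_t (h (eps k.+1 t))%:E = \int[P]_t (h (eps 1%N t))%:E)%E.
Proof.
exact: (ge0_integral_same_law (mfFam (epsI k)) (mfFam (epsI 0)) (eps_law k)).
Qed.

Lemma Y_succ k t : Y k.+1 t = (\sum_(1 <= j < (Y k t).+1) xi k.+1 j t + eps k.+1 t
  + (if k.+1 == s1 then th1 else 0) + (if k.+1 == s2 then th2 else 0))%N.
Proof. by []. Qed.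

(** The factor [(1 + alpha) / 2] is below [1], so the recursion is a contraction up to a constant.
    The outliers are bounded by [th1 + th2] at every time, which keeps that constant independent of
    [k]. *)
Lemma second_moment_recursion k :
  (\int[P]_t (((Y k.+1 t)%:R : R) ^+ 2)%:E <=
   ((1 + alpha) / 2)%:E * \int[P]_t (((Y k t)%:R : R) ^+ 2)%:E
   + ((1 + alpha) / (1 - alpha))%:E *
     (2%:E * \int[P]_t (((eps 1%N t)%:R : R) ^+ 2)%:E
      + (2 * (th1 + th2)%:R ^+ 2)%:E))%E.
Proof.
have /andP[a0 a1] := alpha01.
pose A t : R := (\sum_(1 <= j < (Y k t).+1) xi k.+1 j t)%N%:R.
pose E t : R := (eps k.+1 t)%:R.
pose th : R := (th1 + th2)%:R.
(* Weights with [1 / c1 + 1 / c2 = 1], so that [(u + v)^2 <= c1 u^2 + c2 v^2]; [c1] is tuned to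
   [c1 * alpha = (1 + alpha) / 2], the factor [alpha] coming from thinning. *)
pose c1 := (1 + alpha) / (2 * alpha); pose c2 := (1 + alpha) / (1 - alpha).
have c10 : 0 <= c1 by rewrite /c1 divr_ge0//; lra.
have c20 : 0 <= c2 by rewrite /c2 divr_ge0//; lra.
have A0 t : 0 <= A t by [].
have E0 t : 0 <= E t by [].
have YAE t : (Y k.+1 t)%:R <= A t + (E t + th).
  rewrite /A /E /th -!natrD ler_nat Y_succ -!addnA !leq_add2l.
  by apply: leq_add; case: ifP.
have sqle t : (Y k.+1 t)%:R ^+ 2 <= c1 * A t ^+ 2 + c2 * (2 * E t ^+ 2 + 2 * th ^+ 2).
  apply: (@le_trans _ _ ((A t + (E t + th)) ^+ 2)).
    by rewrite lerXn2r ?nnegrE// (le_trans _ (YAE t)).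
  apply: (@le_trans _ _ (c1 * A t ^+ 2 + c2 * (E t + th) ^+ 2)).
    rewrite -subr_ge0.
    have -> : c1 * A t ^+ 2 + c2 * (E t + th) ^+ 2 - (A t + (E t + th)) ^+ 2 =
       ((1 - alpha) * A t - 2 * alpha * (E t + th)) ^+ 2 / (2 * alpha * (1 - alpha)).
      by rewrite /c1 /c2; field; lra.
    by rewrite divr_ge0 ?sqr_ge0// mulr_ge0//; lra.
  rewrite lerD2l ler_wpM2l//; have := sqr_ge0 (E t - th); lra.
have mA : measurable_fun setT (fun t => (A t ^+ 2)%:E).
  apply/measurable_EFinP/measurable_funX.
  exact: (measurable_fun_nat_comp (fun n => n%:R : R) (measurable_thinning k)).
have mE : measurable_fun setT (fun t => (E t ^+ 2)%:E).
  apply/measurable_EFinP/measurable_funX.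
  exact: (measurable_fun_nat_comp (fun n => n%:R : R) (mfFam (epsI k))).
apply: (@le_trans _ _ (\int[P]_t (c1%:E * (A t ^+ 2)%:E +
   c2%:E * (2%:E * (E t ^+ 2)%:E + (2 * th ^+ 2)%:E)))%E).
  apply: ge0_le_integral => //.
  - apply/measurable_EFinP/measurable_funX.
    exact: (measurable_fun_nat_comp (fun n => n%:R : R) (measurable_Y k.+1)).
  - apply: emeasurable_funD; first exact: measurable_funeM.
    apply: measurable_funeM; apply: emeasurable_funD => //.
    exact: measurable_funeM.
  - by move=> t _; rewrite -!(EFinM, EFinD) lee_fin; exact: sqle.
rewrite ge0_integralD//; last 4 first.
- by move=> t _; rewrite -EFinM lee_fin mulr_ge0 ?sqr_ge0.
- exact: measurable_funeM.
- by move=> t _; rewrite -!(EFinM, EFinD) lee_fin mulr_ge0// addr_ge0 ?mulr_ge0 ?sqr_ge0.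
- apply: measurable_funeM; apply: emeasurable_funD => //.
  exact: measurable_funeM.
rewrite ge0_integralZl_EFin//; last by move=> t _; rewrite lee_fin sqr_ge0.
rewrite ge0_integralZl_EFin//; last 2 first.
- by move=> t _; rewrite -EFinM -EFinD lee_fin addr_ge0 ?mulr_ge0 ?sqr_ge0.
- by apply: emeasurable_funD => //; exact: measurable_funeM.
rewrite ge0_integralD//; last 3 first.
- by move=> t _; rewrite -EFinM lee_fin mulr_ge0 ?sqr_ge0.
- exact: measurable_funeM.
- by move=> t _; rewrite lee_fin mulr_ge0 ?sqr_ge0.
rewrite ge0_integralZl_EFin//; last by move=> t _; rewrite lee_fin sqr_ge0.
rewrite (@integral_cst _ _ _ P _ measurableT (2 * th ^+ 2)%:E).
rewrite [X in (_ + _ * (_ + _ * X))%E](@probability_setT _ _ _ P) mule1.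
rewrite (eps_integral k (h := fun n => n%:R ^+ 2)); last by move=> n; exact: sqr_ge0.
apply: leeD => //.
have -> : ((1 + alpha) / 2)%:E = (c1%:E * alpha%:E)%E.
  by rewrite -EFinM /c1; congr EFin; field; lra.
rewrite -muleA; apply: lee_wpmul2l; first by rewrite lee_fin.
exact: thinning_second_moment.
Qed.

Lemma second_moments_bounded : exists2 M : R, 0 <= M &
  forall k, (\int[P]_t (((Y k t)%:R : R) ^+ 2)%:E <= M%:E)%E.
Proof.
have /andP[a0 a1] := alpha01.
have int0 (Z : T -> nat) : (0 <= \int[P]_t (((Z t)%:R : R) ^+ 2)%:E)%E.
  by apply: integral_ge0 => t _; rewrite lee_fin sqr_ge0.
have /fineK y0E : (\int[P]_t (((Y0 t)%:R : R) ^+ 2)%:E)%E \is a fin_num.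
  by rewrite ge0_fin_numE.
have /fineK e1E : (\int[P]_t (((eps 1%N t)%:R : R) ^+ 2)%:E)%E \is a fin_num.
  by rewrite ge0_fin_numE.
move: (int0 Y0) (int0 (eps 1%N)) second_moment_recursion; rewrite -y0E -e1E.
set y0 := fine _ in y0E *; set e1 := fine _; rewrite !lee_fin => y00 e10 rec.
pose C := (1 + alpha) / (1 - alpha) * (2 * e1 + 2 * (th1 + th2)%:R ^+ 2).
have C0 : 0 <= C.
  apply: mulr_ge0; last by rewrite addr_ge0 ?mulr_ge0 ?sqr_ge0.
  by rewrite divr_ge0//; lra.
(* The second summand is the fixed point of [x -> (1 + alpha) / 2 * x + C]; adding [y0] covers the
   initial value and keeps [M] invariant as an upper bound. *)
pose M := y0 + C / ((1 - alpha) / 2).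
have M0 : 0 <= M by rewrite addr_ge0// divr_ge0//; lra.
exists M => //; elim=> [|k IH].
  by rewrite /Y /= -y0E lee_fin lerDl divr_ge0//; lra.
apply: (le_trans (rec k)).
apply: (@le_trans _ _ (((1 + alpha) / 2)%:E * M%:E + C%:E))%E.
  apply: leeD; last by rewrite -!(EFinM, EFinD).
  by apply: lee_wpmul2l => //; rewrite lee_fin; lra.
rewrite -EFinM -EFinD lee_fin.
have : C <= (1 - alpha) / 2 * M.
  rewrite /M mulrDr mulrCA divff ?mulr1; last by apply/eqP; lra.
  by rewrite lerDr mulr_ge0//; lra.
lra.
Qed.

Lemma sqint_Y k : sqint P (fun t => (Y k t)%:R : R).
Proof.
split; first exact: (measurable_fun_nat_comp (fun n => n%:R : R) (measurable_Y k)).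
have [M _ MP] := second_moments_bounded.
by apply: le_lt_trans (MP k) _; rewrite ltry.
Qed.

Lemma Rsecond_moments_bounded : exists2 M : R, 0 <= M &
  forall k, \int[P]_t (((Y k t)%:R : R) ^+ 2) <= M.
Proof.
have [M M0 MP] := second_moments_bounded; exists M => // k.
by rewrite -lee_fin -fin_Rintegral//; exact: sqint_integrable (sqint_Y k).
Qed.

(** The sum of [Y k ^ 2] over [k < 2^m] has mean at most [M 2^m], hence is a.s. [O((17/8)^m)]. The
    ratio [17/8] lies strictly between [2] and [9/4 = (3/2)^2], so each single [Y k] is eventually
    below [(3/2)^m]. *)
Lemma ae_growth : {ae P, forall t, exists m0, forall m, (m0 <= m)%N ->
  forall k, (k < 2 ^ m)%N -> (Y k t)%:R <= (3 / 2) ^+ m :> R}.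
Proof.
have [M M0 MP] := Rsecond_moments_bounded.
have iY k := sqint_integrable (sqint_Y k).
have : {ae P, forall t, exists K : R, forall m,
    \sum_(0 <= k < 2 ^ m) (Y k t)%:R ^+ 2 <= K * (17 / 8) ^+ m}.
  apply: (@ae_geometric_bound _ _ _ _ _ M _ 2); try lra.
  - move=> m; apply: measurable_sum => k.
    by apply: measurable_funX; exact: (sqint_Y k).1.
  - by move=> m t; apply: sumr_ge0 => k _; exact: sqr_ge0.
  move=> m; rewrite fin_Rintegral; last first.
    rewrite (_ : _ \o _ = fun t =>
        (\sum_(0 <= k < 2 ^ m) (EFin \o (fun t => (Y k t)%:R ^+ 2)%R) t)%E).
      exact: integrable_sum.
    by apply/funext => t /=; rewrite sumEFin.
  rewrite lee_fin Rintegral_sum//.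
  apply: (@le_trans _ _ (\sum_(0 <= k < 2 ^ m) M)); first exact: ler_sum.
  by rewrite sumr_const_nat subn0 -[leLHS]mulr_natr natrX.
apply: filterS => t [K KP].
have K0 : 0 <= K.
  have := KP 0%N; rewrite expr0 mulr1; apply: le_trans.
  by apply: sumr_ge0 => k _; exact: sqr_ge0.
have : (K * (17 / 18) ^+ m) @[m --> \oo] --> (0 : R).
  by apply: cvg_geometric; rewrite ger0_norm; lra.
move/cvgrPdist_le => /(_ 1 ltr01)[m0 _ m0P].
exists m0 => m mm k km.
have p32 : 0 <= (3 / 2) ^+ m :> R by rewrite exprn_ge0//; lra.
rewrite -(ler_pXn2r (n := 2)) ?nnegrE//.
apply: (@le_trans _ _ (K * (17 / 8) ^+ m)).
  apply: le_trans (KP m); rewrite (bigD1_seq k) ?iota_uniq ?mem_index_iota//=.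
  by rewrite lerDl sumr_ge0// => i _; exact: sqr_ge0.
have -> : ((3 / 2) ^+ m) ^+ 2 = (9 / 4) ^+ m :> R.
  by rewrite exprAC; congr (_ ^+ _); field.
have -> : 17 / 8 = 17 / 18 * (9 / 4) :> R by field.
rewrite exprMn mulrA ler_piMl ?exprn_ge0//.
have := m0P m mm; rewrite /= sub0r normrN ger0_norm//.
by rewrite mulr_ge0// exprn_ge0//; lra.
Qed.

(** * Laws of large numbers for immigration and thinning *)

Lemma eps_Rintegral k (h : nat -> R) :
  P.-integrable setT (EFin \o (fun t => h (eps k.+1 t))) ->
  P.-integrable setT (EFin \o (fun t => h (eps 1%N t))) ->
  \int[P]_t h (eps k.+1 t) = \int[P]_t h (eps 1%N t).
Proof.
move=> ik i1; congr fine.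
exact: (integral_same_law (mfFam (epsI k)) (mfFam (epsI 0)) (eps_law k) ik i1).
Qed.

Lemma slln_immigration (g c phi : nat -> R) :
  sqint P (fun t => g (eps 1%N t)) -> \int[P]_t g (eps 1%N t) = 0 ->
  (forall k, `|c k| <= 1) -> (forall n, phi n ^+ 2 <= 1 + n%:R ^+ 2) ->
  {ae P, forall t, sublinear (fun n =>
    \sum_(k < n) g (eps k.+1 t) * (c k * phi (Y k t)))}.
Proof.
move=> sg g0 c1 phi1; have [M M0 MP] := Rsecond_moments_bounded.
have sgk k : sqint P (fun t => g (eps k.+1 t)).
  split; first exact: (measurable_fun_nat_comp g (mfFam (epsI k))).
  rewrite (eps_integral k (h := fun n => g n ^+ 2)); first exact: sg.2.
  by move=> n; exact: sqr_ge0.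
have sq_le k t : (c k * phi (Y k t)) ^+ 2 <= 1 + (Y k t)%:R ^+ 2.
  rewrite exprMn (le_trans _ (phi1 _))// ler_piMl ?sqr_ge0//.
  by rewrite -real_normK ?num_real// exprn_ile1.
have sH k : sqint P (fun t => c k * phi (Y k t)).
  have sY1 := sqintD (sqint_cst P 1) (sqint_Y k).
  apply: sqint_le sY1; first exact: (measurable_fun_nat_comp (fun n => c k * phi n) (measurable_Y k)).
  move=> t; rewrite -(ler_pXn2r (n := 2)) ?nnegrE// !real_normK ?num_real//.
  by rewrite (le_trans (sq_le k t))//; have := ler0n R (Y k t); lra.
pose V := \int[P]_t (g (eps 1%N t) ^+ 2).
have V0 : 0 <= V by apply: Rintegral_ge0 => t _; exact: sqr_ge0.
suff : {ae P, forall t, sublinear (fun n =>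
    \sum_(k < n) \sum_(i <- [:: epsI (k : nat)]) g (Fam i t) * (c k * phi (Y k t)))}.
  by apply: filterS => t; apply: eq_sublinear => n; apply: eq_bigr => k _; rewrite big_seq1.
apply: (@innovation_slln _ _ _ _ P Fam mFam ind (fun k => [:: epsI k]) (fun=> g)
  (fun k _ t => c k * phi (Y k t)) (V * (1 + M))).
- by [].
- by move=> k i; rewrite inE => /eqP ->; exact: sgk.
- move=> k i; rewrite inE => /eqP -> /=; rewrite -g0; apply: eps_Rintegral.
    exact: sqint_integrable1 (sgk k).
  exact: sqint_integrable1 sg.
- move=> k i; rewrite inE => /eqP ->.
  exact: (measurable_fun_nat_comp (fun n => c k * phi n)
     (@measurable_Y_others k (epsI k) (leqnn k))).
- by move=> k i _; exact: sH.
- move=> k l i j; rewrite !inE => /eqP -> /eqP -> lk.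
  have {}lk : (l < k)%N by move: lk; case: (ltngtP l k) => //= ->; rewrite eqxx.
  apply: measurable_funM.
    apply: (measurable_fun_nat_comp g); apply: (@measurable_coordinate_others (epsI k) (epsI l)).
    by apply/eqP => -[] lk'; rewrite lk' ltnn in lk.
  apply: (measurable_fun_nat_comp (fun n => c l * phi n)).
  exact: (@measurable_Y_others l (epsI k) (ltnW lk)).
- move=> m k _; rewrite big_seq1.
  have -> : \int[P]_t (g (Fam (epsI k) t) ^+ 2) = V.
    apply: (eps_Rintegral (h := fun n => g n ^+ 2)).
      exact: sqint_integrable (sgk k).
    exact: sqint_integrable sg.
  rewrite -mulrA ler_wpM2l//.
  apply: (@le_trans _ _ (1 + M)); last first.
    by rewrite ler_peMr ?addr_ge0// exprn_ege1//; lra.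
  apply: (@le_trans _ _ (\int[P]_t (1 + (Y k t)%:R ^+ 2))).
    apply: le_Rintegral => //; first exact: sqint_integrable (sH k).
    rewrite (_ : _ \o _ = (EFin \o (fun=> 1%R)) \+ (EFin \o (fun t => (Y k t)%:R ^+ 2)%R))%E.
      apply: integrableD => //; first exact: sqint_integrable1 (sqint_cst P 1).
      exact: sqint_integrable (sqint_Y k).
    by apply/funext.
  rewrite RintegralD//; last 2 first.
  + exact: sqint_integrable1 (sqint_cst P 1).
  + exact: sqint_integrable (sqint_Y k).
  rewrite lerD// Rintegral_cst// mul1r.
  by rewrite [X in fine X](@probability_setT _ _ _ P).
Qed.
(** For [k > 0], the dyadic scale with [2^(level k - 1) <= k < 2^level k]; it sets the truncation
    height of the [k]-th term. *)
Let level k := (trunc_log 2 k).+1.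

Lemma level_upper k : (k < 2 ^ level k)%N.
Proof. exact: trunc_log_ltn. Qed.

Lemma level_lower k m : (k < 2 ^ m)%N -> (level k <= m.+1)%N.
Proof. by move=> km; rewrite ltnS -(trunc_expnK m (ltnSn 1)) leq_trunc_log// ltnW. Qed.

Lemma xi_center_sqr k j :
  sqint P (fun t => (xi k.+1 j.+1 t)%:R - alpha) /\
  \int[P]_t ((xi k.+1 j.+1 t)%:R - alpha) ^+ 2 <= 1 /\
  \int[P]_t ((xi k.+1 j.+1 t)%:R - alpha) = 0.
Proof.
have /andP[a0 a1] := alpha01.
have m : measurable_fun setT (fun t => (xi k.+1 j.+1 t)%:R - alpha).
  exact: (measurable_fun_nat_comp (fun n => n%:R - alpha) (mfFam (xiI k j))).
have le1 t : `|(xi k.+1 j.+1 t)%:R - alpha| <= 1.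
  by case: (xi _ _ _) (xi_le1 k j t) => [|[|//]] _; rewrite ler_norml; lra.
have s : sqint P (fun t => (xi k.+1 j.+1 t)%:R - alpha).
  by apply: sqint_le (sqint_cst P 1) => // t; rewrite normr1.
have PT : \int[P]_t 1 = 1 :> R.
  by rewrite Rintegral_cst// mul1r [X in fine X](@probability_setT _ _ _ P).
split => //; split.
  rewrite -[leRHS]PT; apply: le_Rintegral => //; first exact: sqint_integrable.
    exact: sqint_integrable1 (sqint_cst P 1).
  by move=> t _; rewrite -real_normK ?num_real// exprn_ile1.
have i : P.-integrable setT (EFin \o (fun t => (xi k.+1 j.+1 t)%:R)).
  have := sqintD s (sqint_cst P alpha) => /sqint_integrable1.
  by rewrite (_ : _ \o _ = EFin \o (fun t => (xi k.+1 j.+1 t)%:R))//;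
    apply/funext => t /=; rewrite subrK.
rewrite RintegralB//; last exact: sqint_integrable1 (sqint_cst P alpha).
rewrite -[X in _ - X](_ : alpha = _); last first.
  by rewrite Rintegral_cst// [X in fine X](@probability_setT _ _ _ P) mulr1.
by apply/eqP; rewrite subr_eq0 -(inj_eq (@EFin_inj R)) -fin_Rintegral// xi_mean.
Qed.

(* The truncation [Y k <= (3 / 2) ^ level k] makes the variance of the [k]-th
   term at most [M (3 / 2) ^ level k]; a.s. it is inactive for large [k]. *)
Lemma slln_survival (c phi : nat -> R) :
  (forall k, `|c k| <= 1) -> (forall n, (0 < n)%N -> phi n ^+ 2 <= n%:R ^+ 2) ->
  {ae P, forall t, sublinear (fun n => \sum_(k < n) c k * (phi (Y k t) *
    \sum_(1 <= j < (Y k t).+1) ((xi k.+1 j t)%:R - alpha)))}.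
Proof.
move=> c1 phi1; have [M M0 MP] := Rsecond_moments_bounded.
pose b (k j y : nat) : R :=
  c k * (phi y * ((j < y)%N && (y%:R <= (3 / 2) ^+ level k :> R))%:R).
pose H k (i : nat + (nat * nat) + unit) t : R :=
  if i is inl (inr (_, j)) then b k j (Y k t) else 0.
(* A finite list is enough: under the truncation [Y k <= (3/2)^level k <= 2^level k], so it includes
   every particle present. *)
pose J (k : nat) := [seq xiI k j | j <- index_iota 0 (2 ^ level k)].
have JP k i : i \in J k -> exists j, i = xiI k j by move=> /mapP[j _ ->]; exists j.
(* Summing over particles contributes a factor [y] on top of [phi y ^ 2 <= y ^ 2]; the truncation
   bounds that one factor and leaves a second moment. *)
have bsq k y (n : nat) : \sum_(0 <= j < n) b k j y ^+ 2 <= (3 / 2) ^+ level k * y%:R ^+ 2.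
  have r0 : 0 <= (3 / 2) ^+ level k :> R by rewrite exprn_ge0//; lra.
  have [yr|yr] := boolP (y%:R <= (3 / 2) ^+ level k :> R); last first.
    rewrite big1 ?mulr_ge0 ?sqr_ge0// => j _.
    by rewrite /b (negPf yr) andbF !mulr0 expr0n.
  (* At [y = 0] the hypothesis on [phi] says nothing, but every indicator [j < y] vanishes. This is
     what admits the constant [phi = 1]. *)
  case: y yr => [|y] yr.
    by rewrite big1 ?mulr_ge0// => j _; rewrite /b ltn0/= !mulr0 expr0n.
  apply: (@le_trans _ _ (\sum_(0 <= j < n) y.+1%:R ^+ 2 * (j < y.+1)%N%:R)).
    apply: ler_sum => j _; rewrite /b yr andbT !exprMn.
    have -> : (j < y.+1)%N%:R ^+ 2 = (j < y.+1)%N%:R :> R.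
      by case: (j < y.+1)%N; rewrite ?expr0n ?expr1n.
    rewrite mulrA ler_wpM2r//.
    apply: le_trans (phi1 _ (ltn0Sn y)); rewrite ler_piMl ?sqr_ge0//.
    by rewrite -real_normK ?num_real// exprn_ile1.
  rewrite -mulr_sumr mulrC ler_wpM2r ?sqr_ge0//; apply: le_trans yr.
  rewrite -natr_sum ler_nat.
  suff -> : (\sum_(0 <= j < n) (j < y.+1) = minn n y.+1)%N by exact: geq_minr.
  elim: n => [|n IH]; first by rewrite big_geq ?min0n.
  by rewrite big_nat_recr//= IH; case: ltnP; lia.
have mb k j i : innovation_after k i ->
    measurable_fun setT ((fun t => b k j (Y k t)) : others Fam i -> R).
  by move=> ki; apply: (measurable_fun_nat_comp (b k j)); exact: measurable_Y_others.
have sb k j : sqint P (fun t => b k j (Y k t)).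
  have := sqintZ ((3 / 2) ^+ level k) (sqint_Y k).
  apply: sqint_le; first exact: (measurable_fun_nat_comp (b k j) (measurable_Y k)).
  move=> t; have r1 : 1 <= (3 / 2) ^+ level k :> R by rewrite exprn_ege1//; lra.
  rewrite -(ler_pXn2r (n := 2)) ?nnegrE// !real_normK ?num_real//.
  have := bsq k (Y k t) j.+1; rewrite big_nat_recr//= => h.
  have : b k j (Y k t) ^+ 2 <= (3 / 2) ^+ level k * (Y k t)%:R ^+ 2.
    by apply: le_trans h; rewrite lerDr sumr_ge0// => i _; exact: sqr_ge0.
  move/le_trans; apply; rewrite [leRHS]exprMn ler_wpM2r ?sqr_ge0//.
  by rewrite expr2 ler_peMl//; lra.
have slln : {ae P, forall t, sublinear (fun n => \sum_(k < n) \sum_(i <- J k)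
    ((Fam i t)%:R - alpha) * H k i t)}.
  apply: (@innovation_slln _ _ _ _ P Fam mFam ind J (fun _ n => n%:R - alpha) H (3 / 2 * M)).
  - by move=> k; rewrite map_inj_uniq ?iota_uniq// => j1 j2 [].
  - by move=> k i /JP[j ->]; have [] := xi_center_sqr k j.
  - by move=> k i /JP[j ->]; have [_ []] := xi_center_sqr k j.
  - by move=> k i /JP[j ->]; exact: (mb k j (xiI k j) (leqnn k)).
  - by move=> k i /JP[j ->]; exact: sb.
  - move=> k l _ _ /JP[i ->] /JP[j ->] lk.
    have {}lk : (l <= k)%N /\ xiI l j != xiI k i.
      case/orP: lk => [lk|/andP[/eqP -> ->]//]; split; first exact: ltnW.
      by apply/eqP => -[lk' _]; rewrite lk' ltnn in lk.
    apply: measurable_funM; last exact: (mb l j (xiI k i) lk.1).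
    apply: (measurable_fun_nat_comp (fun n => n%:R - alpha)).
    exact: (measurable_coordinate_others lk.2).
  - move=> m k km.
    apply: (@le_trans _ _ (\sum_(0 <= j < 2 ^ level k) \int[P]_t (b k j (Y k t) ^+ 2))).
      rewrite big_map; apply: ler_sum => j _.
      rewrite ler_piMl//; first by apply: Rintegral_ge0 => t _; exact: sqr_ge0.
      by have [_ []] := xi_center_sqr k j.
    rewrite -Rintegral_sum; last by move=> j; exact: sqint_integrable (sb k j).
    apply: (@le_trans _ _ (\int[P]_t ((3 / 2) ^+ level k * (Y k t)%:R ^+ 2))).
      apply: le_Rintegral => //.
      + rewrite (_ : _ \o _ = fun t =>
            (\sum_(0 <= j < 2 ^ level k) (EFin \o (fun t => b k j (Y k t) ^+ 2)%R) t)%E).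
          by apply: integrable_sum => // j *; exact: sqint_integrable (sb k j).
        by apply/funext => t /=; rewrite sumEFin.
      + rewrite (_ : _ \o _ = fun t =>
            (((3 / 2) ^+ level k)%:E * (EFin \o (fun t => (Y k t)%:R ^+ 2)%R) t)%E).
          by apply: integrableZl => //; exact: sqint_integrable (sqint_Y k).
        by apply/funext => t /=; rewrite -EFinM.
    rewrite RintegralZl//; last exact: sqint_integrable (sqint_Y k).
    have -> : 3 / 2 * M * (3 / 2) ^+ m = (3 / 2) ^+ m.+1 * M :> R by rewrite exprS; ring.
    apply: ler_pM => //.
      by apply: Rintegral_ge0 => t _; exact: sqr_ge0.
    by rewrite ler_weXn2l//; [lra|exact: level_lower].
apply: filterS2 slln ae_growth => t slln [m0 m0P].
pose x k := \sum_(i <- J k) ((Fam i t)%:R - alpha) * H k i t.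
pose y k := c k * (phi (Y k t) * \sum_(1 <= j < (Y k t).+1) ((xi k.+1 j t)%:R - alpha)).
refine (@sublinear_sum_eventually _ x y (2 ^ m0)%N _ slln) => k mk; rewrite /x /y.
have kl : (m0 <= level k)%N.
  by rewrite ltnW// ltnS -(trunc_expnK m0 (ltnSn 1)) leq_trunc_log.
have Yr := m0P _ kl k (level_upper k).
have Yl : (Y k t <= 2 ^ level k)%N.
  rewrite -(ler_nat R) (le_trans Yr)// natrX lerXn2r ?nnegrE//; lra.
rewrite big_map (big_cat_nat (leq0n _) Yl)/=.
rewrite addrC big_nat big1 => [|j /andP[Yj _]]; last first.
  by rewrite /b ltnNge Yj/= !mulr0.
rewrite add0r big_add1/= !mulr_sumr !big_nat; apply: eq_bigr => j /andP[_ jY].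
by rewrite /b jY Yr mulr1 mulrC mulrA.
Qed.
(* [Yd k] is [Y k] without particle 1 of the last generation, hence independent of [xi k 1]. *)
Let Yd k t := inar (Y0 t) (fun k => eps k t)
  (fun l j => if (l == k) && (j == 1%N) then 0%N else xi l j t) s1 s2 th1 th2 k.

Lemma le_Yd k t : (Yd k t <= Y k t)%N.
Proof. by apply: le_inar => l j; case: ifP. Qed.

Lemma measurable_Yd_others k i : (i == xiI k 0) || innovation_after k.+1 i ->
  measurable_fun setT (Yd k.+1 : others Fam i -> nat).
Proof.
move=> ki; apply: (@measurable_inar _ (others Fam i) Y0 eps
  (fun l j t => if (l == k.+1) && (j == 1%N) then 0%N else xi l j t)) => [|l lk|l j lk].
- apply: (@measurable_coordinate_others i (inr tt)).
  by apply: contraL ki => /eqP <-.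
- apply: (@measurable_coordinate_others i (epsI l)).
  by apply: contraL ki => /eqP <- /=; rewrite -ltnNge.
case: (boolP ((l.+1 == k.+1) && (j.+1 == 1%N))) => [_|lj]; first exact: measurable_cst.
apply: (@measurable_coordinate_others i (xiI l j)).
apply: contraL ki => /eqP <- /=; rewrite negb_or -leqNgt -ltnS lk andbT.
by apply: contra lj => /eqP[-> ->]; rewrite !eqxx.
Qed.

(** Positive immigration at time [k.+1] makes [Y k.+1] positive, so particle 1 really occurs in the
    next thinning sum; deleting it changes nothing before time [k.+2]. *)
Lemma Y_first_particle k t : eps k.+1 t != 0%N ->
  Y k.+2 t = (Yd k.+2 t + xi k.+2 1%N t)%N.
Proof.
move=> e0; rewrite Y_succ /Yd inarS.
rewrite -(@eq_inar _ _ (fun l j => xi l j t)) => [|l j lk]; last first.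
  by rewrite eqSS (ltn_eqF lk).
rewrite -/(Y k.+1 t).
have Y1 : (1 < (Y k.+1 t).+1)%N by rewrite Y_succ; lia.
rewrite (big_ltn Y1) [in RHS](big_ltn Y1) eqxx /=.
rewrite [in RHS](eq_big_nat _ _ (F2 := fun j => xi k.+2 j t)) => [|j /andP[j1 _]]; first lia.
by rewrite (gtn_eqF j1).
Qed.

(** The weight contains [eps k.+2] and the other particles of time [k.+2], but not particle 1, so it
    is measurable for [others] of that particle. The case [psi = 1] controls the sum of [w], and the
    identity controls the part of [Y w] coming from the remaining population. *)
Lemma slln_particle (c psi : nat -> R) :
  (forall k, `|c k| <= 1) -> (forall n, psi n ^+ 2 <= 1 + n%:R ^+ 2) ->
  {ae P, forall t, sublinear (fun n => \sum_(k < n)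
    ((xi k.+2 1%N t)%:R - alpha) * (c k * ((eps k.+1 t != 0%N)%:R * psi (Yd k.+2 t))))}.
Proof.
move=> c1 psi1; have [M M0 MP] := Rsecond_moments_bounded.
pose H k t := c k * ((eps k.+1 t != 0%N)%:R * psi (Yd k.+2 t)).
have mHo k i : i != epsI k -> (i == xiI k.+1 0) || innovation_after k.+2 i ->
    measurable_fun setT (H k : others Fam i -> R).
  move=> ik ki; apply: measurable_funM => //; apply: measurable_funM.
    apply: (measurable_fun_nat_comp (fun n => (n != 0%N)%:R : R)).
    by apply: (@measurable_coordinate_others i (epsI k)); rewrite eq_sym.
  by apply: (measurable_fun_nat_comp psi); exact: measurable_Yd_others.
have sq_le k t : H k t ^+ 2 <= 1 + (Y k.+2 t)%:R ^+ 2.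
  apply: (@le_trans _ _ (1 + (Yd k.+2 t)%:R ^+ 2)); last first.
    by rewrite lerD2l lerXn2r ?nnegrE// ler_nat le_Yd.
  apply: le_trans (psi1 _); rewrite /H mulrA exprMn ler_piMl ?sqr_ge0//.
  rewrite -real_normK ?num_real// exprn_ile1// normrM.
  by case: (_ != _); rewrite /= ?normr1 ?normr0 ?mulr0 ?mulr1 ?ler01.
have sH k : sqint P (H k).
  have sY1 := sqintD (sqint_cst P 1) (sqint_Y k.+2).
  apply: sqint_le sY1.
    apply: (measurable_fun_others mFam (i := xiI k.+1 0)).
    by apply: mHo; rewrite ?eqxx.
  move=> t; rewrite -(ler_pXn2r (n := 2)) ?nnegrE// !real_normK ?num_real//.
  by rewrite (le_trans (sq_le k t))//; have := ler0n R (Y k.+2 t); lra.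
suff : {ae P, forall t, sublinear (fun n => \sum_(k < n)
    \sum_(i <- [:: xiI (k : nat).+1 0]) ((Fam i t)%:R - alpha) * H k t)}.
  by apply: filterS => t; apply: eq_sublinear => n; apply: eq_bigr => k _; rewrite big_seq1.
apply: (@innovation_slln _ _ _ _ P Fam mFam ind (fun k => [:: xiI k.+1 0])
  (fun _ n => n%:R - alpha) (fun k _ => H k) (1 + M)).
- by [].
- by move=> k i; rewrite inE => /eqP ->; have [] := xi_center_sqr k.+1 0.
- by move=> k i; rewrite inE => /eqP ->; have [_ []] := xi_center_sqr k.+1 0.
- by move=> k i; rewrite inE => /eqP ->; apply: mHo; rewrite ?eqxx.
- by move=> k i _; exact: sH.
- move=> k l i j; rewrite !inE => /eqP -> /eqP -> lk.
  have {}lk : (l < k)%N by move: lk; case: (ltngtP l k) => //= ->; rewrite eqxx.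
  apply: measurable_funM; last by apply: mHo => //=; rewrite ltnS lk orbT.
  apply: (measurable_fun_nat_comp (fun n => n%:R - alpha)).
  apply: (@measurable_coordinate_others (xiI k.+1 0) (xiI l.+1 0)).
  by apply/eqP => -[lk']; rewrite lk' ltnn in lk.
move=> m k _; rewrite big_seq1.
have [_ [V1 _]] := xi_center_sqr k.+1 0.
have H2 : \int[P]_t (H k t ^+ 2) <= 1 + M.
  apply: (@le_trans _ _ (\int[P]_t (1 + (Y k.+2 t)%:R ^+ 2))).
    apply: le_Rintegral => //; first exact: sqint_integrable (sH k).
    rewrite (_ : _ \o _ = (EFin \o (fun=> 1%R)) \+ (EFin \o (fun t => (Y k.+2 t)%:R ^+ 2)%R))%E.
      apply: integrableD => //; first exact: sqint_integrable1 (sqint_cst P 1).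
      exact: sqint_integrable (sqint_Y k.+2).
    by apply/funext.
  rewrite RintegralD//; last 2 first.
  + exact: sqint_integrable1 (sqint_cst P 1).
  + exact: sqint_integrable (sqint_Y k.+2).
  by rewrite lerD// Rintegral_cst// mul1r [X in fine X](@probability_setT _ _ _ P).
have H0 : 0 <= \int[P]_t (H k t ^+ 2) by apply: Rintegral_ge0 => t _; exact: sqr_ge0.
apply: (@le_trans _ _ (1 * (1 + M))).
  by apply: ler_pM => //; apply: Rintegral_ge0 => t _; exact: sqr_ge0.
by rewrite mul1r ler_peMr ?addr_ge0// exprn_ege1//; lra.
Qed.

(** * Residual sums and the test sequence *)

Let wt (k : nat) : R := ((k.+1 != s1) && (k.+1 != s2))%:R.

Lemma wt_le1 k : `|wt k| <= 1.
Proof. by rewrite /wt; case: (_ && _); rewrite ?normr1 ?normr0. Qed.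

Lemma sstar_weight n (f : nat -> R) :
  sstar n s1 s2 f = \sum_(k < n) wt k * f k.+1.
Proof.
rewrite /sstar big_add1/= big_mkord big_mkcond/=; apply: eq_bigr => k _.
by rewrite /wt; case: ifP => _; rewrite ?mul1r ?mul0r.
Qed.

Lemma eps_sqint k : sqint P (fun t => (eps k.+1 t)%:R : R).
Proof.
split; first exact: (measurable_fun_nat_comp (fun n => n%:R : R) (mfFam (epsI k))).
by rewrite (eps_integral k (h := fun n => n%:R ^+ 2))// => n; exact: sqr_ge0.
Qed.

(** Away from the outlier times the residual is exactly the centred immigration plus the centred
    thinning; at the outlier times the weight [wt] vanishes, so the outlier sizes never enter. *)
Lemma slln_residual (phi : nat -> R) :
  (forall n, (0 < n)%N -> phi n ^+ 2 <= n%:R ^+ 2) ->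
  (forall n, phi n ^+ 2 <= 1 + n%:R ^+ 2) ->
  {ae P, forall t, sublinear (fun n => sstar n s1 s2 (fun k =>
    phi (Y k.-1 t) * ((Y k t)%:R - alpha * (Y k.-1 t)%:R - mu)))}.
Proof.
move=> phi1 phi2.
have PT : \int[P]_t 1 = 1 :> R.
  by rewrite Rintegral_cst// mul1r [X in fine X](@probability_setT _ _ _ P).
have sg : sqint P (fun t => (eps 1%N t)%:R - mu).
  exact: sqintD (eps_sqint 0) (sqint_cst P (- mu)).
have g0 : \int[P]_t ((eps 1%N t)%:R - mu) = 0.
  rewrite RintegralB//; last 2 first.
  - exact: sqint_integrable1 (eps_sqint 0).
  - exact: sqint_integrable1 (sqint_cst P mu).
  rewrite /Rintegral eps_mean /= integral_cst//.
  by rewrite [X in (_ * X)%E](@probability_setT _ _ _ P) mule1 subrr.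
have A := slln_immigration (g := fun n => n%:R - mu) sg g0 wt_le1 phi2.
have B := slln_survival wt_le1 phi1.
apply: filterS2 A B => t A B; apply: eq_sublinear (sublinearD A B) => n.
rewrite sstar_weight -big_split/=; apply: eq_bigr => k _.
rewrite /wt; case: (boolP (_ && _)) => [/andP[k1 k2]|_]; last by rewrite !mul0r mulr0 addr0.
rewrite Y_succ (negPf k1) (negPf k2) !addn0 !mul1r natrD.
rewrite sumrB sumr_const_nat subn1/= -natr_sum -mulr_natr; ring.
Qed.
(* Test sequence correlated with [Y k]: the centred survival of particle 1 at
   time [k], used only if immigration at time [k - 1] guarantees it exists. *)
Let w t k : R :=
  if k is k'.+2 then ((xi k'.+2 1%N t)%:R - alpha) * (eps k'.+1 t != 0%N)%:R else 0.

Lemma w_le1 t k : `|w t k| <= 1.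
Proof.
have /andP[a0 a1] := alpha01.
case: k => [|[|k]] /=; rewrite ?normr0// normrM mulr_ile1//.
  by case: (xi _ _ _) (xi_le1 k.+1 0 t) => [|[|//]] _; rewrite ler_norml; lra.
by case: (_ != _); rewrite ?normr1 ?normr0.
Qed.

(** The lag shifts the range to times [0] to [n - 1], and the first two values vanish. The truncated
    [n - 2] also gives the empty sum for [n < 2]. *)
Lemma sstar_lag2 n (z : nat -> R) : z 0%N = 0 -> z 1%N = 0 ->
  sstar n s1 s2 (fun k => z k.-1) = \sum_(k < n - 2) wt k.+2 * z k.+2.
Proof.
move=> z0 z1; rewrite sstar_weight /=; case: n => [|[|n]].
- by rewrite !big_ord0.
- by rewrite big_ord1 big_ord0 z0 mulr0.
by rewrite !big_ord_recl /= z0 z1 !mulr0 !add0r !subSS subn0; apply: eq_bigr.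
Qed.

Lemma wt2_le1 k : `|wt k.+2| <= 1.
Proof. exact: wt_le1. Qed.

Lemma ae_sum_w : {ae P, forall t,
  sublinear (fun n => sstar n s1 s2 (fun k => w t k.-1))}.
Proof.
have H := slln_particle wt2_le1 (psi := fun=> 1).
have /H : forall n : nat, (1 : R) ^+ 2 <= 1 + n%:R ^+ 2.
  by move=> n; rewrite expr1n lerDl sqr_ge0.
apply: filterS => t /(sublinear_shift 2); apply: eq_sublinear => n.
rewrite sstar_lag2//; apply: eq_bigr => k _ /=; rewrite mulr1; ring.
Qed.

(** Let [x] be the survival indicator of particle 1. As [x ^ 2 = x], [(Yd + x) (x - alpha)] equals
    [Yd (x - alpha) + (1 - alpha) (x - alpha) + alpha (1 - alpha)]. The first two parts average out
    by [L1] and [L2], the constant occurs with frequency [p] by [L3], and [Lw] accounts for the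
    excluded times; the limiting average is [q]. *)
Lemma ae_sum_yw : (0 < P (eps 1%N @^-1` [set m | m != 0%N]))%E ->
  exists2 c : R, 0 < c & {ae P, forall t, exists n0, forall n, (n0 <= n)%N ->
    c * n%:R <= sstar n s1 s2 (fun k => (Y k.-1 t)%:R * w t k.-1)}.
Proof.
have /andP[a0 a1] := alpha01.
set A := eps 1%N @^-1` _ => PA0.
have mA : measurable A by exact: meps.
have PAfin : P A \is a fin_num by exact: fin_num_measure.
pose p := fine (P A).
have p0 : 0 < p by rewrite fine_gt0// PA0/= -ge0_fin_numE.
pose g (n : nat) : R := (n != 0%N)%:R - p.
have i0 : \int[P]_t (eps 1%N t != 0%N)%:R = p :> R.
  rewrite /p -[A]setIT -(integral_indic P measurableT mA); congr fine.
  apply: eq_integral => t _; rewrite indicE /A; congr (_%:R)%:E.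
  by case E : (eps 1%N t) => [|n]; [rewrite memNset//= E|rewrite mem_set//= E].
have s0 : sqint P (fun t => (eps 1%N t != 0%N)%:R : R).
  apply: sqint_le (sqint_cst P 1).
    exact: (measurable_fun_nat_comp (fun n => (n != 0%N)%:R : R) (mfFam (epsI 0))).
  by move=> t; rewrite normr1; case: (_ != _); rewrite ?normr1 ?normr0.
have sg : sqint P (fun t => g (eps 1%N t)) by exact: sqintD s0 (sqint_cst P (- p)).
have g0 : \int[P]_t g (eps 1%N t) = 0.
  rewrite /g RintegralB//; last 2 first.
  - exact: sqint_integrable1 s0.
  - exact: sqint_integrable1 (sqint_cst P p).
  rewrite i0 Rintegral_cst// [X in fine X](@probability_setT _ _ _ P) mulr1; exact: subrr.
have one_le (n : nat) : (1 : R) ^+ 2 <= 1 + n%:R ^+ 2 by rewrite expr1n lerDl sqr_ge0.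
have id_le (n : nat) : (n%:R : R) ^+ 2 <= 1 + n%:R ^+ 2 by rewrite lerDr.
have L1 := slln_particle wt2_le1 (psi := fun n => n%:R) id_le.
have L2 := slln_particle wt2_le1 (psi := fun=> 1) one_le.
have L3 := slln_immigration sg g0 wt2_le1 (phi := fun=> 1) one_le.
pose q := alpha * (1 - alpha) * p.
have q0 : 0 < q by rewrite !mulr_gt0//; lra.
have Lw : sublinear (fun n => \sum_(k < n) (wt k.+2 - 1)).
  pose x (k : nat) : R := 0; pose y (k : nat) := wt k.+2 - 1.
  refine (@sublinear_sum_eventually _ x y (s1 + s2) _ _) => [k ks|].
    have k1 : k.+3 != s1 by apply/eqP; lia.
    have k2 : k.+3 != s2 by apply/eqP; lia.
    by rewrite /x /y /wt k1 k2 subrr.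
  by apply: (@sublinear_bounded _ _ 0) => n; rewrite big1// normr0.
exists (q / 2); first by rewrite divr_gt0.
apply: filterS3 L1 L2 L3 => t L1 L2 L3.
have L : sublinear (fun n => \sum_(k < n) (wt k.+2 * ((Y k.+2 t)%:R * w t k.+2) - q)).
  have := sublinearD (sublinearD L1 (sublinearZ (1 - alpha) L2))
    (sublinearD (sublinearZ (alpha * (1 - alpha)) L3) (sublinearZ q Lw)).
  apply: eq_sublinear => n; rewrite !mulr_sumr -!big_split/=; apply: eq_bigr => k _.
  rewrite /g /w; have [e0|e0] := eqVneq (eps k.+1 t) 0%N.
    by rewrite (_ : (~~ true)%:R = 0 :> R)// /q; ring.
  rewrite (Y_first_particle e0) natrD (_ : (~~ false)%:R = 1 :> R)// /q.
  have := xi_idem k.+1 0 t; set x := (xi _ _ _)%:R => xx.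
  have -> : ((Yd k.+2 t)%:R + x) * ((x - alpha) * 1) =
    (Yd k.+2 t)%:R * (x - alpha) + x ^+ 2 - alpha * x by ring.
  by rewrite xx; ring.
(* The error costs [q n / 8] and the two missing terms cost [2 q <= q n / 4] once [n >= 8], which
   leaves more than [q n / 2]. *)
have q8 : 0 < q / 8 by rewrite divr_gt0.
have [n0 n0P] := sublinear_shift 2 L q8.
exists (n0 + 8)%N => n hn.
have h8 : 8 <= n%:R :> R by rewrite (ler_nat R 8) (leq_trans _ hn)// leq_addl.
rewrite (@sstar_lag2 n (fun k => (Y k t)%:R * w t k)); rewrite ?mulr0//.
have := n0P n (leq_trans (leq_addr _ _) hn).
rewrite sumrB sumr_const card_ord -[q *+ _]mulr_natr natrB; last first.
  by rewrite (leq_trans _ (leq_trans (leq_addl n0 8) hn)).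
rewrite ler_norml => /andP[lo _]; move: lo; set s := \sum_(_ < _) _ => lo.
have qn : 8 * q <= q * n%:R by rewrite mulrC ler_pM2l.
lra.
Qed.

Lemma ae_estimators :
  (0 < P (eps 1%N @^-1` [set m | m != 0%N]))%E ->
  (0 < s1)%N -> (0 < s2)%N -> s1 != s2 ->
  let y t k := (Y k t)%:R : R in
  {ae P, forall t,
    (exists n0 : nat, forall n : nat, (n0 <= n)%N ->
     unique_global_minimizer (Qn (y t) n s1 s2)
       (alpha_hat (y t) n s1 s2) (mu_hat (y t) n s1 s2)
       (theta_hat (y t) n s1 s2 s1) (theta_hat (y t) n s1 s2 s2)) /\
    [/\ alpha_hat (y t) n s1 s2 @[n --> \oo] --> alpha,
        mu_hat (y t) n s1 s2 @[n --> \oo] --> mu,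
        theta_hat (y t) n s1 s2 s1 @[n --> \oo] --> y t s1 - alpha * y t s1.-1 - mu
      & theta_hat (y t) n s1 s2 s2 @[n --> \oo] --> y t s2 - alpha * y t s2.-1 - mu]}.
Proof.
move=> PA0 s1_gt0 s2_gt0 s12 y.
have /andP[_ a1] := alpha01.
have [c' c'0 Lyw] := ae_sum_yw PA0.
have L1 : {ae P, forall t, sublinear (fun n => sstar n s1 s2 (fun k =>
    1 * ((Y k t)%:R - alpha * (Y k.-1 t)%:R - mu)))}.
  apply: (slln_residual (phi := fun=> 1)) => n; last by rewrite expr1n lerDl sqr_ge0.
  by move=> n0; rewrite expr1n exprn_ege1// ler1n.
have L2 : {ae P, forall t, sublinear (fun n => sstar n s1 s2 (fun k =>
    (Y k.-1 t)%:R * ((Y k t)%:R - alpha * (Y k.-1 t)%:R - mu)))}.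
  by apply: (slln_residual (phi := fun n => n%:R)) => n //; rewrite lerDr.
have Lw := ae_sum_w.
apply: filter_app L1; apply: filterS3 L2 Lw Lyw => t H2 H3 H4 H1.
have {}H1 : sublinear (fun n => sstar n s1 s2 (fun k => y t k - alpha * y t k.-1 - mu)).
  by apply: eq_sublinear H1 => n; apply: eq_sstar => k; rewrite mul1r.
have y0 k : 0 <= y t k by [].
split.
  exact: (eventually_minimizer s1_gt0 s2_gt0 s12 y0 a1 H1 c'0 (w_le1 t) H3 H4).
split.
- exact: (alpha_hat_cvg s1_gt0 s2_gt0 s12 y0 a1 H1 H2 c'0 (w_le1 t) H3 H4).
- exact: (mu_hat_cvg s1_gt0 s2_gt0 s12 y0 a1 H1 H2 c'0 (w_le1 t) H3 H4).
- exact: (theta_hat_cvg s1_gt0 s2_gt0 s12 y0 a1 H1 H2 c'0 (w_le1 t) H3 H4).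
- exact: (theta_hat_cvg s1_gt0 s2_gt0 s12 y0 a1 H1 H2 c'0 (w_le1 t) H3 H4).
Qed.

End inar_process.

(** * From survival indicators bounded everywhere to almost surely Bernoulli ones *)

Lemma mutually_independent_comp {d : measure_display} {T : measurableType d}
    {R : realType} (P : probability T R) {I : eqType} (X X' : I -> T -> nat)
    (h : I -> nat -> nat) : (forall i t, X' i t = h i (X i t)) ->
  mutually_independent P X -> mutually_independent P X'.
Proof.
move=> X'E ind J B uJ.
have E i : X' i @^-1` B i = X i @^-1` (h i @^-1` B i).
  by apply/seteqP; split => t; rewrite /preimage/= X'E.
under eq_bigr do rewrite E; rewrite ind//.
by apply: eq_bigr => i _; rewrite E.
Qed.

Lemma ae_bernoulli {d : measure_display} {T : measurableType d} {R : realType}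
    (P : probability T R) (X : T -> nat) (a : R) :
  (forall B : set nat, measurable (X @^-1` B)) ->
  P (X @^-1` [set 1%N]) = a%:E -> P (X @^-1` [set 0%N]) = (1 - a)%:E ->
  {ae P, forall t, X t = (X t == 1%N)}.
Proof.
move=> mX P1 P0; exists (~` (X @^-1` [set 0%N] `|` X @^-1` [set 1%N])); split.
- by apply: measurableC; apply: measurableU; exact: mX.
- have d01 : X @^-1` [set 0%N] `&` X @^-1` [set 1%N] = set0.
    by apply/seteqP; split => // t [/= -> ].
  rewrite probability_setC; last by apply: measurableU; exact: mX.
  rewrite (measureU _ (mX _) (mX _) d01).
  have s : (P (X @^-1` [set 0%N]) + P (X @^-1` [set 1%N]) = 1)%E.
    by rewrite P0 P1 -EFinD subrK.
  by transitivity (1 - 1 : \bar R)%E; [congr (_ - _)%E; exact: s|rewrite subee].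
- by move=> t /= h [] E; apply: h; rewrite E.
Qed.

Theorem theorem4p5p1 (R : realType) (d : measure_display) (T : measurableType d)
  (P : probability T R) (alpha mu : R)
  (eps : nat -> T -> nat) (xi : nat -> nat -> T -> nat) (Y0 : T -> nat)
  (s1 s2 th1 th2 : nat) :
  0 < alpha < 1 ->
  (0 < s1)%N -> (0 < s2)%N -> s1 != s2 -> (0 < th1)%N -> (0 < th2)%N ->
  (forall k (B : set nat), measurable (eps k.+1 @^-1` B)) ->
  (forall k j (B : set nat), measurable (xi k.+1 j.+1 @^-1` B)) ->
  (forall B : set nat, measurable (Y0 @^-1` B)) ->
  mutually_independent P (inar_family eps xi Y0) ->
  (forall k (B : set nat), P (eps k.+1 @^-1` B) = P (eps 1%N @^-1` B)) ->
  (forall k j, P (xi k.+1 j.+1 @^-1` [set 1%N]) = alpha%:E /\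
               P (xi k.+1 j.+1 @^-1` [set 0%N]) = (1 - alpha)%:E) ->
  (\int[P]_t (((eps 1%N t)%:R : R) ^+ 2)%:E < +oo)%E ->
  (0 < P (eps 1%N @^-1` [set m | m != 0%N]))%E ->
  (\int[P]_t (((Y0 t)%:R : R) ^+ 2)%:E < +oo)%E ->
  (\int[P]_t (((eps 1%N t)%:R : R))%:E = mu%:E)%E ->
  let Y := fun t k =>
    ((inar (Y0 t) (fun k => eps k t) (fun k j => xi k j t) s1 s2 th1 th2 k)%:R : R) in
  {ae P, forall t, exists n0 : nat, forall n : nat, (n0 <= n)%N ->
     unique_global_minimizer (Qn (Y t) n s1 s2)
       (alpha_hat (Y t) n s1 s2) (mu_hat (Y t) n s1 s2)
       (theta_hat (Y t) n s1 s2 s1) (theta_hat (Y t) n s1 s2 s2)} /\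
  {ae P, forall t,
     [/\ alpha_hat (Y t) n s1 s2 @[n --> \oo] --> alpha,
         mu_hat (Y t) n s1 s2 @[n --> \oo] --> mu,
         theta_hat (Y t) n s1 s2 s1 @[n --> \oo] --> Y t s1 - alpha * Y t s1.-1 - mu
       & theta_hat (Y t) n s1 s2 s2 @[n --> \oo] --> Y t s2 - alpha * Y t s2.-1 - mu]}.
Proof.
move=> alpha01 s1_gt0 s2_gt0 s12 _ _ meps mxi mY0 ind eps_law xi_law eps2 PA0 Y02 eps_mean Y.
(* [xi] is [0/1]-valued a.s. only; [xi'] is so everywhere. *)
pose xi' k j t : nat := xi k j t == 1%N.
have mxi' k j (B : set nat) : measurable (xi' k.+1 j.+1 @^-1` B).
  exact: (mxi k j ((fun n => n == 1%N : nat) @^-1` B)).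
have xi'1 k j t : (xi' k.+1 j.+1 t <= 1)%N by rewrite /xi'; case: eqP.
have ind' : mutually_independent P (inar_family eps xi' Y0).
  apply: (mutually_independent_comp (h := fun i n =>
    if i is inl (inr _) then (n == 1%N : nat) else n)) ind.
  by move=> [[k|[k j]]|[]] t.
have xi'_law k j : P (xi' k.+1 j.+1 @^-1` [set 1%N]) = alpha%:E.
  rewrite -(xi_law k j).1; congr (P _); apply/seteqP; split => t; rewrite /xi' /=.
    by case: eqP.
  by move=> ->.
have xi'E : {ae P, forall t, forall k j, xi k.+1 j.+1 t = xi' k.+1 j.+1 t}.
  apply: ae_foralln => k; apply: ae_foralln => j.
  by apply: (ae_bernoulli (a := alpha)); [exact: mxi|exact: (xi_law k j).1|exact: (xi_law k j).2].
have main := ae_estimators th1 th2 alpha01 meps mxi' mY0 xi'1 ind' eps_law xi'_law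
  eps2 Y02 eps_mean PA0 s1_gt0 s2_gt0 s12.
have {}main : {ae P, forall t,
    (exists n0 : nat, forall n : nat, (n0 <= n)%N ->
     unique_global_minimizer (Qn (Y t) n s1 s2)
       (alpha_hat (Y t) n s1 s2) (mu_hat (Y t) n s1 s2)
       (theta_hat (Y t) n s1 s2 s1) (theta_hat (Y t) n s1 s2 s2)) /\
    [/\ alpha_hat (Y t) n s1 s2 @[n --> \oo] --> alpha,
        mu_hat (Y t) n s1 s2 @[n --> \oo] --> mu,
        theta_hat (Y t) n s1 s2 s1 @[n --> \oo] --> Y t s1 - alpha * Y t s1.-1 - mu
      & theta_hat (Y t) n s1 s2 s2 @[n --> \oo] --> Y t s2 - alpha * Y t s2.-1 - mu]}.
  apply: filterS2 xi'E main => t xiE.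
  suff -> : Y t = (fun k => (inar (Y0 t) (fun k => eps k t) (fun k j => xi' k j t)
      s1 s2 th1 th2 k)%:R) by [].
  by apply/funext => k; congr (_%:R); apply: eq_inar => l j _; exact: xiE.
by split; apply: filterS main => t [].
Qed.
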